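(* Let $k$ be an algebraically closed field, let $R$ be a commutative affine (i.e. finitely generated) $k$-algebra graded by a torsionfree abelian group $G$, and let $A$ be the twist of $R$ by a $2$-cocycle $c:G\times G\to k^\times$. Assume either that $-1$ is not in the subgroup of $k^\times$ generated by the image of $c$, or that $\operatorname{char}k=2$. Then there exist topological quotient maps $$\operatorname{spec}R\rightarrow\operatorname{spec}A\qquad\text{and}\qquad\operatorname{max}R\rightarrow\operatorname{prim}A.$$
   Context: Twist: if $R$ is a $k$-algebra graded by an (additive) abelian group $G$ and $c:G\times G\to k^\times$ is a $2$-cocycle, the twist of $R$ by $c$ is the $G$-graded $k$-algebra $R'$ equipped with a $G$-graded $k$-linear isomorphism $R\to R'$, $r\mapsto r'$, such that $r's'=c(\alpha,\beta)(rs)'$ for homogeneous $r'\in R'_\alpha$, $s'\in R'_\beta$ and all $\alpha,\beta\in G$. $\operatorname{spec}$ of a ring is its set of prime ideals (an ideal $P$ is prime if it is proper and contains no product of two ideals neither of which is contained in $P$), with the Zariski topology whose closed sets are the sets $\{P\mid P\supseteq I\}$ for ideals $I$; $\operatorname{prim}$ (left primitive ideals) and $\operatorname{max}$ (maximal ideals) carry the relative topology. A map $\phi:X\to Y$ of topological spaces is a topological quotient map if it is surjective and a subset $W\subseteq Y$ is closed exactly when $\phi^{-1}(W)$ is closed in $X$. *)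

(* Defs.v *)
From HB Require Import structures.
From mathcomp Require Import all_boot all_order all_algebra.
From mathcomp Require Import all_classical topology.

Set Implicit Arguments.
Unset Strict Implicit.
Unset Printing Implicit Defensive.

Import GRing.Theory.

Local Open Scope classical_set_scope.
Local Open Scope ring_scope.

Section Ideals.
Variable A : pzRingType.
Implicit Types (I J P : {pred A}).

Definition two_sided_ideal I : Prop :=
  zmod_closed I /\
  forall a x : A, x \in I -> (a * x \in I) /\ (x * a \in I).

(* The ideal product: finite sums of products. *)
Definition ideal_mul I J : {pred A} :=
  [pred z : A | `[< exists s : seq (A * A),
     (forall u, u \in s -> u.1 \in I /\ u.2 \in J) /\
     z = \sum_(u <- s) u.1 * u.2 >]].

Definition proper_two_sided_ideal I : Prop :=
  two_sided_ideal I /\ exists x : A, x \notin I.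

Definition prime_two_sided_ideal P : Prop :=
  proper_two_sided_ideal P /\
  forall I J, two_sided_ideal I -> two_sided_ideal J ->
    {subset ideal_mul I J <= P} -> {subset I <= P} \/ {subset J <= P}.

Definition maximal_two_sided_ideal P : Prop :=
  proper_two_sided_ideal P /\
  forall J, two_sided_ideal J -> {subset P <= J} -> J =i P \/ J =i predT.

Definition simple_module (M : lmodType A) : Prop :=
  (exists m : M, m != 0) /\
  forall N : {pred M}, submod_closed N -> N =i pred1 0 \/ N =i predT.

Definition left_primitive P : Prop :=
  exists2 M : lmodType A, simple_module M &
    forall a : A, a \in P <-> forall m : M, a *: m = 0.

Lemma ideal0 I : two_sided_ideal I -> 0 \in I.
Proof. by case=> -[]. Qed.

Lemma idealN I x : two_sided_ideal I -> x \in I -> - x \in I.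
Proof. by case=> -[I0 IB] _ Ix; rewrite -sub0r IB. Qed.

Lemma idealD I x y : two_sided_ideal I -> x \in I -> y \in I -> x + y \in I.
Proof.
move=> hI Ix Iy; rewrite -[y]opprK; case: (hI) => -[_ IB] _.
by apply: IB => //; apply: idealN.
Qed.

Lemma ideal_sum I (T : eqType) (s : seq T) (F : T -> A) :
  two_sided_ideal I -> (forall u, u \in s -> F u \in I) ->
  \sum_(u <- s) F u \in I.
Proof.
move=> hI hF; rewrite big_seq; elim/big_ind: _ => //; first exact: ideal0.
by move=> x y; apply: idealD.
Qed.

Lemma ideal_mulP I J x y : x \in I -> y \in J -> x * y \in ideal_mul I J.
Proof.
move=> Ix Jy; apply/asboolP; exists [:: (x, y)].
by rewrite big_seq1; split=> [u|//]; rewrite mem_seq1 => /eqP ->.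
Qed.

Lemma ideal_mul_subI I J x : two_sided_ideal I -> two_sided_ideal J ->
  x \in ideal_mul I J -> (x \in I) /\ (x \in J).
Proof.
move=> hI hJ /asboolP[s [hs ->]].
split; apply: ideal_sum => // u /hs [u1 u2].
- by case: (hI) => _ /(_ u.2 u.1 u1) [].
- by case: (hJ) => _ /(_ u.1 u.2 u2) [].
Qed.

Lemma proper1 I : proper_two_sided_ideal I -> 1 \notin I.
Proof.
case=> -[_ hI] [x]; apply: contraNN => /(hI x) [+ _].
by rewrite mulr1.
Qed.

Lemma maximal_prime P : maximal_two_sided_ideal P -> prime_two_sided_ideal P.
Proof.
move=> [pP maxP]; split=> // I J hI hJ sIJ.
have hP : two_sided_ideal P by case: pP.
have key K : two_sided_ideal K -> ~ {subset K <= P} ->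
    exists2 x, x \in K & 1 - x \in P.
  move=> hK nKP.
  pose Q : {pred A} := [pred z : A | `[< exists2 x, x \in K & z - x \in P >]].
  have hQ : two_sided_ideal Q.
    split; first split.
    - by apply/asboolP; exists 0; rewrite ?subrr; apply: ideal0.
    - move=> x y /asboolP[u Ku Pu] /asboolP[v Kv Pv].
      apply/asboolP; exists (u - v).
        by apply: idealD => //; apply: idealN.
      by rewrite opprD addrACA -opprD; case: (hP) => -[_ PB] _; apply: PB.
    - move=> a x /asboolP[u Ku Pu].
      case: (hK) => _ /(_ a u Ku) [Kau Kua].
      case: (hP) => _ /(_ a _ Pu) []; rewrite mulrBr mulrBl => Pau Pua.
      by split; apply/asboolP; [exists (a * u)|exists (u * a)].
  have sPQ : {subset P <= Q}.
    move=> x Px; apply/asboolP; exists 0; first exact: ideal0.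
    by rewrite subr0.
  case: (maxP Q hQ sPQ) => eQ; last first.
    by apply/asboolP; have := eQ 1; rewrite inE => ->.
  case: nKP => x Kx; rewrite -eQ; apply/asboolP; exists x => //.
  by rewrite subrr ideal0.
have [sI|nI] := pselect {subset I <= P}; first by left.
have [sJ|nJ] := pselect {subset J <= P}; first by right.
have [x Ix Px] := key I hI nI; have [y Jy Py] := key J hJ nJ.
have /negP[] := proper1 pP.
have -> : 1 = x * y + ((1 - x) * y + (1 - y)) :> A.
  by rewrite addrA -mulrDl addrC [x + _]addrC subrK mul1r subrK.
apply: idealD => //; first exact/sIJ/ideal_mulP.
by apply: idealD => //; case: (hP) => _ /(_ y _ Px) [].
Qed.

Lemma left_primitive_prime P : left_primitive P -> prime_two_sided_ideal P.
Proof.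
move=> [M [[m0 m0n0] simM] hP].
have idP : two_sided_ideal P.
  split; first split.
  - by apply/hP => m; rewrite scale0r.
  - by move=> x y /hP Px /hP Py; apply/hP => m; rewrite scalerBl Px Py subrr.
  - move=> a x /hP Px; split; apply/hP => m; rewrite -scalerA Px //.
    by rewrite scaler0.
split.
  split=> //; exists 1; apply/negP => /hP /(_ m0); rewrite scale1r => m00.
  by rewrite m00 eqxx in m0n0.
move=> I J hI hJ sIJ.
have [sJ|nJ] := pselect {subset J <= P}; [by right | left].
(* the elements killed by I form a submodule, nonzero since it contains JM *)
pose N : {pred M} := [pred m : M | `[< forall a, a \in I -> a *: m = 0 >]].
have hN : submod_closed N.
  split; first by apply/asboolP => a _; rewrite scaler0.
  move=> b u v /asboolP Nu /asboolP Nv; apply/asboolP => a Ia.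
  rewrite scalerDr Nv // addr0 scalerA; apply: Nu.
  by case: (hI) => _ /(_ b a Ia) [].
case: (simM N hN) => eN; last first.
  move=> a Ia; apply/hP => m.
  have : m \in N by rewrite eN.
  by move=> /asboolP; apply.
case: nJ => b Jb; apply/hP => m; apply/eqP.
have : b *: m \in N; last by rewrite eN.
apply/asboolP => a Ia; rewrite scalerA.
by apply: (hP _).1; apply/sIJ/ideal_mulP.
Qed.

End Ideals.

Record spec (A : pzRingType) := Spec {
  spec_pred :> {pred A};
  spec_prime : prime_two_sided_ideal spec_pred }.

HB.instance Definition _ (A : pzRingType) := gen_eqMixin (spec A).
HB.instance Definition _ (A : pzRingType) := gen_choiceMixin (spec A).

Section Zariski.
Variable A : pzRingType.

Definition zariski_closed (I : {pred A}) : set (spec A) :=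
  [set P : spec A | {subset I <= (P : {pred A})}].

Definition zariski_open (U : set (spec A)) : Prop :=
  exists2 I : {pred A}, two_sided_ideal I & U = ~` zariski_closed I.

Lemma zariski_openT : zariski_open setT.
Proof.
exists (fun=> true); first by split.
rewrite -setC0; congr (~` _); apply/esym/seteqP; split=> // P /= sP.
have [pP _] := spec_prime P.
by have /negP[] := proper1 pP; apply: sP.
Qed.

Lemma zariski_openI : setI_closed zariski_open.
Proof.
move=> _ _ [I hI ->] [J hJ ->].
exists (fun x => (x \in I) && (x \in J)).
  case: (hI) (hJ) => -[I0 IB] IM [[J0 JB] JM]; split; first split.
  - by apply/andP.
  - by move=> x y /andP[? ?] /andP[? ?]; apply/andP; rewrite !(IB, JB).
  - move=> a x /andP[/(IM a)[? ?] /(JM a)[? ?]].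
    by split; apply/andP.
rewrite -setCU; congr (~` _); apply/seteqP; split=> P /=.
  by case=> sP x /andP[? ?]; apply: sP.
move=> sP; have [_ hP] := spec_prime P; apply: (hP I J) => // x xIJ.
by apply: sP; apply/andP/ideal_mul_subI.
Qed.

Lemma zariski_open_bigU (T : Type) (f : T -> set (spec A)) :
  (forall i, zariski_open (f i)) -> zariski_open (\bigcup_i f i).
Proof.
move=> hf.
pose upper (J : {pred A}) := two_sided_ideal J /\ forall i (I : {pred A}),
  two_sided_ideal I -> f i = ~` zariski_closed I -> {subset I <= J}.
exists (fun x => `[< forall J, upper J -> x \in J >]).
  split; first split.
  - by apply/asboolP => J [[[]]].
  - move=> x y /asboolP hx /asboolP hy; apply/asboolP => J hJ.
    by have [[[_ JB] _] _] := hJ; apply: JB; [exact: hx|exact: hy].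
  - move=> a x /asboolP hx; split; apply/asboolP => J hJ;
    by have [[_ /(_ a x (hx _ hJ))[]]] := hJ.
rewrite -[LHS]setCK setC_bigcup; congr (~` _); apply/seteqP; split=> P /=.
  move=> hP x /asboolP; apply; split; first by have [[]] := spec_prime P.
  by move=> i I hI fi; have := hP i Logic.I; rewrite fi setCK.
move=> hP i _; have [I hI fi] := hf i; rewrite fi /= => -[] x Ix.
by apply: hP; apply/asboolP => J [_ /(_ i I hI fi)]; apply.
Qed.

HB.instance Definition _ := isOpenTopological.Build (spec A)
  zariski_openT zariski_openI zariski_open_bigU.

Lemma closed_specE (W : set (spec A)) : closed W <->
  exists2 I : {pred A}, two_sided_ideal I & W = zariski_closed I.
Proof.
rewrite -openC; split=> -[I hI eW]; exists I => //.
  by rewrite -[W]setCK eW setCK.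
by rewrite eW.
Qed.

(* As subsets of [spec A]; see [maximal_prime] and [left_primitive_prime].
   The library topologizes a set, coerced to a type, as a subspace. *)
Definition maxspec : set (spec A) := [set P | maximal_two_sided_ideal P].

Definition primspec : set (spec A) := [set P | left_primitive P].

End Zariski.

Arguments maxspec : clear implicits.
Arguments primspec : clear implicits.

Definition topological_quotient_map (X Y : topologicalType) (f : X -> Y) :=
  range f = [set: Y] /\
  forall W : set Y, closed W <-> closed (f @^-1` W).

Definition torsionfree (G : zmodType) :=
  forall (g : G) (n : nat), (0 < n)%N -> g *+ n = 0 -> g = 0.

Section Algebras.
Variables (G : zmodType) (k : fieldType).

Definition affine (R : algType k) : Prop :=
  exists s : seq R, forall S : {pred R},
    subalg_closed S -> {subset s <= S} -> S =i predT.

(* R is the internal direct sum of the RG g; that 1 lies in RG 0 is automatic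
   since G is a group. *)
Definition grading (R : algType k) (RG : G -> {pred R}) : Prop :=
  [/\ forall g, submod_closed (RG g),
      forall g h, {in RG g & RG h, forall r s, r * s \in RG (g + h)},
      forall r : R, exists (s : seq G) (f : G -> R),
        (forall g, f g \in RG g) /\ r = \sum_(g <- s) f g &
      forall (s : seq G) (f : G -> R), uniq s -> (forall g, f g \in RG g) ->
        \sum_(g <- s) f g = 0 -> {in s, forall g, f g = 0}].

Definition two_cocycle (c : G -> G -> k) : Prop :=
  (forall a b, c a b != 0) /\
  forall a b d, c a b * c (a + b) d = c b d * c a (b + d).

(* [phi] is r |-> r'. It need not map 1 to 1, as c is not assumed
   normalized. *)
Definition is_twist (c : G -> G -> k)
    (R : algType k) (RG : G -> {pred R}) (A : algType k) (AG : G -> {pred A})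
    (phi : {linear R -> A}) : Prop :=
  [/\ grading AG, bijective phi,
      forall g r, (phi r \in AG g) = (r \in RG g) &
      forall a b, {in RG a & RG b, forall r s,
        phi r * phi s = c a b *: phi (r * s)}].

(* Membership in the subgroup of the unit group of k generated by X. *)
Definition in_generated_subgroup (X : set k) (x : k) : Prop :=
  forall H : {pred k}, divr_closed H -> 0 \notin H ->
    (forall y, X y -> y \in H) -> x \in H.

End Algebras.

(* Main.v *)
Require Import Defs.
From HB Require Import structures.
From mathcomp Require Import all_boot all_order all_algebra.
From mathcomp Require Import all_classical topology.
From mathcomp Require Import generic_quotient ring_quotient mpoly.

Set Implicit Arguments.
Unset Strict Implicit.
Unset Printing Implicit Defensive.

Import Order.TTheory GRing.Theory.

Local Open Scope classical_set_scope.
Local Open Scope ring_scope.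

(** Since phi is a graded linear bijection, A may be viewed as the vector
space R with a second product.  After rescaling phi on the homogeneous
components, the cocycle is an alternating bicharacter c such that
phi r * phi s = c g h *: phi (r * s) in degrees g and h, and such that
c g h ^+ 2 = 1 forces c g h = 1 ([normalized_cocycle]).  The last property is
where the value -1 is excluded: in A, homogeneous elements of degrees g and h
commute up to c g h ^+ 2, so degrees that commute in A have c g h = 1, and
there the two products agree.

The quotient map sends a prime P of R to [core P], the largest two-sided ideal
of A whose inverse image under phi lies in P.  Let D be the set of degrees of
the homogeneous elements outside P, and call two degrees equivalent when c h
takes the same value on both for every h in D.  The equivalence classes define
a coarser grading, with components [part D g0 r].  Multiplying an element of an
ideal of A on the left and on the right by a homogeneous element outside P
scales its parts differently, so that the parts can be separated
([ideal_class_component]).  Hence phi q lies in core P exactly when all parts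
of q lie in P ([core_parts]), and core P is prime ([core_prime]).

Conversely, let Q be a prime of A and Qr its inverse image in R.  By the same
separation, Qr is an ideal of R, generated as a group by the parts of its
elements, and it is prime as far as elements with a single part are concerned
([preim_ideal], [preim_class_prime]).  A prime of R lies over Q if it contains
Qr and no other element with a single part; such primes are mapped to Q
([lies_over_core]), and Qr is their intersection ([exists_lies_over]).  The
topological statement is formal from there ([core_quotient_map]).  The inverse
image of a closed set is closed because the inclusion of a given ideal in
core P is a closed condition on P.  If the inverse image of W is the set of
primes containing I, then phi maps I into every member of W, since I lies in
all primes over that member; so whenever Q contains the intersection of W, any
prime over Q contains I, and Q belongs to W.

For maximal and primitive ideals the fibres must also contain enough maximal
ideals.  If P is maximal, then R / P is k by the commutative Nullstellensatz,
so that modulo core P every component of the coarser grading is at most a line;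
a power of one suitable homogeneous u lies in every ideal strictly above core P,
and a maximal left ideal avoiding u yields a faithful simple module of
A / core P ([core_kernel_primitive]).  If Q is primitive, a noncommutative
Nullstellensatz ([simple_endomorphism_scalar]) makes elements with the same
single part proportional modulo Q ([primitive_class_proportional]); then a
k-point of R at which Qr vanishes lies over Q as soon as a single element u is
nonzero there, and the commutative Nullstellensatz provides enough such points
([exists_maximal_lies_over]). *)

(** * Maximal subsets and prime ideals *)

(** Zorn's lemma above a given member; only nonempty chains need a union in F,
because the empty one is bounded by B. *)
Lemma Zorn_above (T : Type) (F : set (set T)) (B : set T) : F B ->
  (forall C : set (set T), C `<=` F -> C !=set0 -> total_on C subset ->
     F (\bigcup_(X in C) X)) ->
  exists M, [/\ B `<=` M, F M & forall N, M `<=` N -> F N -> N `<=` M].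
Proof.
move=> FB FU; have [|X [FX Xmax]] := @Zorn_bigcup T [set X | F (B `|` X)].
  move=> C CF Ctot; have [->|/set0P[X0 CX0]] := eqVneq C set0.
    by rewrite /= bigcup_set0 setU0.
  suff eU : B `|` \bigcup_(X in C) X = \bigcup_(Y in [set B `|` X | X in C]) Y.
    rewrite /= eU; apply: FU => [_ [X CX <-]||]; first exact: CF.
      by exists (B `|` X0), X0.
    move=> _ _ [X CX <-] [Y CY <-].
    by case: (Ctot _ _ CX CY) => XY; [left|right]; exact: setUS.
  rewrite bigcup_image; apply/seteqP; split=> x.
    by move=> [Bx|[X CX Xx]]; [exists X0 => //; left|exists X => //; right].
  by move=> [X CX [Bx|Xx]]; [left|right; exists X].
exists (B `|` X); split=> [||N BXN FN]; [exact: subsetUl|exact: FX|].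
apply: contrapT => NX; apply: (Xmax N).
  rewrite properEneq; split.
    by apply/eqP => eXN; apply: NX; rewrite -eXN; exact: subsetUr.
  by move=> x Xx; apply: BXN; right.
by rewrite /= setUidr // => x Bx; apply: BXN; left.
Qed.

Lemma exists_minimizer (T : Type) (m : T -> nat) (Q : T -> Prop) :
  (exists x, Q x) -> exists2 x, Q x & forall y, Q y -> (m x <= m y)%N.
Proof.
move=> [x Qx]; have [n le_n] := ubnP (m x); elim: n x Qx le_n => // n IH x Qx.
rewrite ltnS => le_n; have [[y Qy lt_y]|no] := pselect (exists2 y, Q y & (m y < m x)%N).
  by apply: (IH y Qy); exact: leq_trans le_n.
by exists x => // y Qy; rewrite leqNgt; apply/negP => lt_y; apply: no; exists y.
Qed.

(** One notion for additive subgroups, one-sided ideals and multiplicative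
subgroups, so that Zorn's lemma is applied to all of them at once. *)
Definition operation_closed (T : Type) (e : T) (I : Type)
    (op : I -> T -> T -> T) (L : {pred T}) :=
  e \in L /\ forall i x y, x \in L -> y \in L -> op i x y \in L.

Lemma maximal_operation_closed (T : Type) (e : T) (I : Type)
    (op : I -> T -> T -> T) (S : T -> Prop) (L0 : {pred T}) :
  operation_closed e op L0 -> (forall x, S x -> x \notin L0) ->
  exists L, [/\ operation_closed e op L, {subset L0 <= L},
    forall x, S x -> x \notin L &
    forall L', operation_closed e op L' -> {subset L <= L'} ->
      (forall x, S x -> x \notin L') -> {subset L' <= L}].
Proof.
move=> clL0 L0S; pose pr (X : set T) : {pred T} := [pred x | `[< X x >]].
have prP X x : reflect (X x) (x \in pr X) by apply: asboolP.
have prK L : pr [set x | x \in L] =i L by move=> x; apply/prP/idP.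
have clpr L : operation_closed e op L -> operation_closed e op (pr [set x | x \in L]).
  by case=> Le Lop; split=> [|i x y]; rewrite !prK //; apply: Lop.
pose F : set (set T) :=
  [set X | operation_closed e op (pr X) /\ forall x, S x -> ~ X x].
have [||X [L0X [clX XS] Xmax]] := @Zorn_above T F [set x | x \in L0].
- by split; [exact: clpr|move=> x /L0S; apply/negP].
- move=> C CF [X0 CX0] Ctot; split; last by move=> x Sx [X /CF[_ /(_ x Sx)]].
  split; first by apply/prP; exists X0 => //; apply/prP; case: (CF _ CX0) => -[].
  move=> i x y /prP[X CX Xx] /prP[Y CY Yy]; apply/prP.
  have hop Z : C Z -> Z x -> Z y -> (\bigcup_(W in C) W) (op i x y).
    move=> CZ Zx Zy; exists Z => //; apply/prP.
    by case: (CF _ CZ) => -[_ Zop] _; apply: Zop; apply/prP.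
  by case: (Ctot X Y CX CY) => XY; [apply: (hop Y)|apply: (hop X)] => //; apply: XY.
exists (pr X); split=> // [x L0x|x /XS Xx|L' clL' sX L'S x L'x].
- exact/prP/L0X.
- by apply/negP => /prP.
apply/prP; apply: (Xmax [set y | y \in L']) => //.
  by move=> y Xy; apply/sX/prP.
by split; [exact: clpr|move=> y /L'S; apply/negP].
Qed.

Definition stable_subgroup (V : zmodType) (I : Type) (op : I -> V -> V)
    (L : {pred V}) :=
  zmod_closed L /\ forall i x, x \in L -> op i x \in L.

Lemma zmod_closed_add (V : zmodType) (L : {pred V}) x y :
  zmod_closed L -> x \in L -> y \in L -> x + y \in L.
Proof. by move=> [L0 LB] Lx Ly; rewrite -[y]opprK LB // -sub0r LB. Qed.

Lemma maximal_stable_subgroup (V : zmodType) (I : Type) (op : I -> V -> V)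
    (S : V -> Prop) (L0 : {pred V}) :
  stable_subgroup op L0 -> (forall x, S x -> x \notin L0) ->
  exists L, [/\ stable_subgroup op L, {subset L0 <= L},
    forall x, S x -> x \notin L &
    forall L', stable_subgroup op L' -> {subset L <= L'} ->
      (forall x, S x -> x \notin L') -> {subset L' <= L}].
Proof.
pose op' (o : option I) (x y : V) := if o is Some i then op i x else x - y.
have stE L : stable_subgroup op L <-> operation_closed 0 op' L.
  split=> [[[L0' LB] Lop]|[L0' Lop]].
    by split=> // -[i|] x y; [move=> Lx _; apply: Lop|apply: LB].
  split; first by split=> // x y; apply: (Lop None).
  by move=> i x Lx; apply: (Lop (Some i) x x).
move=> /stE clL0 /(maximal_operation_closed clL0)[L [/stE stL L0L LS Lmax]].
by exists L; split=> // L' /stE; apply: Lmax.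
Qed.

Section Ideals.
Variable A : nzRingType.
Implicit Types (I J P Q : {pred A}).

(** The elements a' with a' A b inside P form a two-sided ideal I, and so do the
b' with I b' inside P; their product is inside P. *)
Lemma prime_idealP P : prime_two_sided_ideal P ->
  forall a b : A, (forall x, a * x * b \in P) -> a \in P \/ b \in P.
Proof.
move=> [[idP _] prP] a b axb.
pose I : {pred A} := [pred a' | `[< forall x, a' * x * b \in P >]].
pose J : {pred A} := [pred b' | `[< forall a', a' \in I -> a' * b' \in P >]].
have IP a' : reflect (forall x, a' * x * b \in P) (a' \in I) by apply: asboolP.
have JP b' : reflect (forall a', a' \in I -> a' * b' \in P) (b' \in J).
  exact: asboolP.
have [[P0 PB] PM] := idP.
have idI : two_sided_ideal I.
  split; first split.
  - by apply/IP => x; rewrite !mul0r.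
  - by move=> u v /IP hu /IP hv; apply/IP => x; rewrite !mulrBl PB.
  - move=> y u /IP hu; split; apply/IP => x; last by rewrite -(mulrA u).
    by rewrite -!mulrA [u * _]mulrA; case: (PM y _ (hu x)).
have idJ : two_sided_ideal J.
  split; first split.
  - by apply/JP => x _; rewrite mulr0.
  - by move=> u v /JP hu /JP hv; apply/JP => x Ix; rewrite mulrBr PB ?hu ?hv.
  - move=> y u /JP hu; split; apply/JP => x Ix; rewrite mulrA.
      by apply: hu; case: idI => _ /(_ y x Ix)[].
    by case: (PM y _ (hu x Ix)).
have [z /asboolP[s [hs ->]]|sP|sP] := prP I J idI idJ.
- by apply: ideal_sum => // u /hs[u1 /JP]; apply.
- by left; apply/sP/IP.
- by right; apply/sP/JP => a' /IP/(_ 1); rewrite mulr1.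
Qed.

Lemma prime_intro P : proper_two_sided_ideal P ->
  (forall I J, two_sided_ideal I -> two_sided_ideal J ->
     forall a b, a \in I -> a \notin P -> b \in J -> b \notin P ->
     exists2 z, z \in ideal_mul I J & z \notin P) ->
  prime_two_sided_ideal P.
Proof.
move=> pP hP; split=> // I J hI hJ sIJ.
have [|nI] := pselect {subset I <= P}; [by left|right=> b Jb].
apply/negPn/negP => Pb; apply: nI => a Ia.
apply/negPn/negP => Pa; have [z /sIJ zP] := hP I J hI hJ a b Ia Pa Jb Pb.
by rewrite zP.
Qed.

End Ideals.

Lemma ideal_comm (R : comNzRingType) (I : {pred R}) :
  stable_subgroup *%R I <-> two_sided_ideal I.
Proof.
split=> -[IB IM]; split=> // a x Ix; last by case: (IM a x Ix).
by rewrite [x * a]mulrC; split; apply: IM.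
Qed.

Lemma prime_comm (R : comNzRingType) (P : {pred R}) :
  prime_two_sided_ideal P -> forall a b, a * b \in P -> a \in P \/ b \in P.
Proof.
move=> prP a b abP; apply: prime_idealP => // x; rewrite mulrAC.
by case: prP => -[[_ PM] _] _; case: (PM x _ abP).
Qed.

Lemma prime_comm_intro (R : comNzRingType) (P : {pred R}) :
  two_sided_ideal P -> 1 \notin P ->
  (forall a b, a * b \in P -> a \in P \/ b \in P) -> prime_two_sided_ideal P.
Proof.
move=> idP P1 PM; apply: prime_intro => [|I J _ _ a b Ia Pa Jb Pb].
  by split=> //; exists 1.
exists (a * b); first exact: ideal_mulP.
by apply/negP => /PM[]; apply/negP.
Qed.

(** An ideal maximal among those that contain Q and miss S is prime. *)
Lemma prime_avoiding (R : comNzRingType) (S : R -> Prop) (Q : {pred R}) :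
  two_sided_ideal Q -> S 1 -> (forall a b, S a -> S b -> S (a * b)) ->
  (forall a, S a -> a \notin Q) ->
  exists P, [/\ prime_two_sided_ideal P, {subset Q <= P} &
                forall a, S a -> a \notin P].
Proof.
move=> /ideal_comm idQ S1 SM SQ.
have [P [idP QP PS Pmax]] := maximal_stable_subgroup idQ SQ.
exists P; split=> //; have [[P0 PB] PM] := idP.
have PD x y : x \in P -> y \in P -> x + y \in P.
  by apply: idealD; apply/ideal_comm.
apply: prime_comm_intro; [exact/ideal_comm|exact: PS|].
(* By maximality the ideal generated by P and a meets S. *)
have key a : a \notin P -> exists2 b, S b & exists r, b - r * a \in P.
  move=> Pa; pose J : {pred R} := [pred b | `[< exists r, b - r * a \in P >]].
  have JP b : reflect (exists r, b - r * a \in P) (b \in J) by apply: asboolP.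
  apply: contrapT => nS; move/negP: Pa; apply; apply: (Pmax J).
  - split; first split.
    + by apply/JP; exists 0; rewrite mul0r subr0.
    + move=> u v /JP[r hr] /JP[s hs]; apply/JP; exists (r - s).
      have -> : u - v - (r - s) * a = u - r * a - (v - s * a).
        by rewrite mulrBl !opprB addrACA [- v + _]addrC addrACA.
      exact: PB.
    + move=> u v /JP[r hr]; apply/JP; exists (u * r).
      by rewrite -mulrA -mulrBr; apply: PM.
  - by move=> b Pb; apply/JP; exists 0; rewrite mul0r subr0.
  - by move=> b Sb; apply/negP => /JP hb; apply: nS; exists b.
  - by apply/JP; exists 1; rewrite mul1r subrr.
move=> a b Pab; apply: contrapT => /not_orP[/negP/key[s Ss [r hr]]].
move=> /negP/key[t St [r' hr']]; have /negP[] := PS _ (SM _ _ Ss St).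
have -> : s * t = t * (s - r * a) + (r * a) * (t - r' * b) + (r * r') * (a * b).
  rewrite !mulrBr [t * (r * a)]mulrC addrA subrK mulrA [r * a * r']mulrAC.
  by rewrite -[r * r' * a * b]mulrA subrK mulrC.
by apply: (PD); [apply: (PD)|]; apply: PM.
Qed.

(** * The commutative Nullstellensatz *)

(** Let D0 be the prime ideal of the constants in P.  The lemmas below do
polynomial arithmetic over the domain D / D0 without forming that ring: the
predicate coefs_in expresses that a polynomial vanishes over D / D0, and trunc
drops the leading term. *)
Section OneVariable.
Variables (k : closedFieldType) (D : comNzRingType) (P : {pred {poly D}}).
Hypothesis prP : prime_two_sided_ideal P.
Implicit Types (p q r s : {poly D}).

Let idealP : two_sided_ideal P. Proof. by case: prP => -[]. Qed.
Let P0 : 0 \in P. Proof. exact: ideal0. Qed.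
Let PD p q : p \in P -> q \in P -> p + q \in P. Proof. exact: idealD. Qed.
Let PB p q : p \in P -> q \in P -> p - q \in P.
Proof. by case: idealP => -[_ h] _; apply: h. Qed.
Let PM p q : q \in P -> p * q \in P.
Proof. by move=> Pq; case: idealP => _ /(_ p q Pq)[]. Qed.
Let Pprime p q : p * q \in P -> p \in P \/ q \in P.
Proof. exact: prime_comm. Qed.

Definition coefs_in q := forall i, (q`_i)%:P \in P.

Let coefs_inP q : coefs_in q -> q \in P.
Proof.
move=> Nq; rewrite -[q]coefK poly_def; apply: ideal_sum => // i _.
by rewrite -mul_polyC mulrC; apply: PM.
Qed.

Let trunc q := q - lead_coef q *: 'X^((size q).-1).

Let size_trunc q : q != 0 -> (size (trunc q) < size q)%N.
Proof.
move=> q0; have q1 : (0 < size q)%N by rewrite lt0n size_poly_eq0.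
rewrite -(prednK q1) ltnS; apply/leq_sizeP => i le_i.
rewrite coefB coefZ coefXn; have [->|ne] := eqVneq i (size q).-1.
  by rewrite mulr1 -lead_coefE subrr.
rewrite mulr0 subr0 nth_default // -(prednK q1) ltn_neqAle eq_sym ne //.
Qed.

Let coefs_trunc q : (lead_coef q)%:P \in P -> coefs_in (q - trunc q).
Proof.
move=> lq i; rewrite opprB addrC subrK coefZ coefXn.
by case: eqP => _; rewrite ?mulr1 // mulr0.
Qed.

Let trunc_P q : (lead_coef q)%:P \in P -> (trunc q \in P) = (q \in P).
Proof.
move=> /coefs_trunc/coefs_inP h; apply/idP/idP => hq.
  by rewrite -(subrK (trunc q) q); apply: PD.
by rewrite -[trunc q](subKr q); apply: PB.
Qed.

Let coefs_inD p q : coefs_in p -> coefs_in q -> coefs_in (p + q).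
Proof. by move=> hp hq i; rewrite coefD polyCD; apply: PD. Qed.

Let min_lead q : q \in P -> ~ coefs_in q ->
    (forall r, r \in P /\ ~ coefs_in r -> (size q <= size r)%N) ->
  (lead_coef q)%:P \notin P.
Proof.
move=> Pq Nq qmin; apply/negP => lq.
have q0 : q != 0.
  by apply/eqP => q0; apply: Nq => i; rewrite q0 coef0.
have := size_trunc q0; rewrite ltnNge qmin //; split; first by rewrite trunc_P.
move=> h; apply: Nq; rewrite -(subrK (trunc q) q).
exact: (coefs_inD (coefs_trunc lq)).
Qed.

Let Ppow a n : a%:P \notin P -> (a ^+ n)%:P \notin P.
Proof.
move=> Pa; elim: n => [|n IH]; first by apply: proper1; case: prP.
by rewrite exprS polyCM; apply/negP => /Pprime[]; apply/negP.
Qed.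

(** If P comes from D0, the coordinate x of the point is free, and it suffices
that some coefficient of f survives.  Otherwise x must be a root of a
polynomial p of P that is minimal over D / D0, which exists once the leading
coefficient a of p survives; and f does not vanish at x because a multiple of f
is congruent modulo P to a nonzero constant d. *)
Lemma extend_one_variable f : f \notin P -> exists2 d : D, d%:P \notin P &
  forall e : {rmorphism D -> k}, (forall x, x%:P \in P -> e x = 0) -> e d != 0 ->
  exists x, (forall p, p \in P -> (map_poly e p).[x] = 0) /\
            (map_poly e f).[x] != 0.
Proof.
move=> Pf; have map0 (e : {rmorphism D -> k}) p :
    (forall x, x%:P \in P -> e x = 0) -> coefs_in p -> map_poly e p = 0.
  by move=> eP Np; apply/polyP => i; rewrite coef_map coef0 /= eP.
have [algP|trP] := pselect (exists p, p \in P /\ ~ coefs_in p); last first.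
  have [i Pi] : exists i, (f`_i)%:P \notin P.
    apply: contrapT => no; move/negP: Pf; apply; apply: coefs_inP => i.
    by apply/negPn/negP => Pi; apply: no; exists i.
  exists f`_i => // e eP ei.
  have /closed_nonrootP[x fx] : map_poly e f != 0.
    by apply: contraNneq ei => f0; rewrite -coef_map f0 coef0.
  exists x; split=> // p Pp; rewrite (map0 e) ?horner0 //.
  by apply: contrapT => Np; apply: trP; exists p.
have [p [Pp Np] pmin] := exists_minimizer (fun q : {poly D} => size q) algP.
have Pa := min_lead Pp Np pmin; set a := lead_coef p in Pa.
have small q : q \in P -> (size q < size p)%N -> coefs_in q.
  move=> Pq lt_q; apply: contrapT => Nq.
  by have := pmin q (conj Pq Nq); rewrite leqNgt lt_q.
have p0 : p != 0.
  by rewrite -lead_coef_eq0 -/a; apply: contraNneq Pa => ->.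
(* The Euclidean algorithm for f and p over D / D0: among the multiples of f
   modulo P, one of least degree is a constant. *)
pose modf q := ~~ (q \in P) /\ exists v, q - v * f \in P.
have : exists q, modf q by exists f; split=> //; exists 1; rewrite mul1r subrr.
move=> /(exists_minimizer (fun q : {poly D} => size q))[r [Pr [v Pvf]] rmin].
have lt_rp : (size r < size p)%N.
  have eqf := Pdiv.ComRing.rdivp_eq p f.
  set m := Pdiv.CommonRing.rscalp f p in eqf.
  set t := Pdiv.CommonRing.rdivp f p in eqf.
  set f' := Pdiv.CommonRing.rmodp f p in eqf.
  apply: (@leq_ltn_trans (size f')); last exact: Pdiv.CommonRing.ltn_rmodpN0.
  have eqf' : f' = (a ^+ m)%:P * f - t * p by rewrite mul_polyC eqf addrC addKr.
  apply: rmin; split.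
    rewrite eqf'; apply/negP => h.
    have /Pprime[] : (a ^+ m)%:P * f \in P.
    - by rewrite -(subrK (t * p) (_ * f)); apply: PD => //; apply: PM.
    - by apply/negP/Ppow.
    - exact/negP.
  by exists (a ^+ m)%:P; rewrite eqf' addrAC subrr sub0r -mulNr; apply: PM.
have r0 : r != 0 by apply: contraNneq Pr => ->.
have Pb : (lead_coef r)%:P \notin P.
  apply/negP => lr; have := size_trunc r0; rewrite ltnNge rmin //.
  split; first by rewrite trunc_P.
  exists v; rewrite -[trunc r - _](subrK (r - v * f)); apply: PD => //.
  by rewrite opprB addrA subrK -[trunc r - r]opprB -sub0r; apply: PB => //;
    apply/coefs_inP/coefs_trunc.
(* Otherwise divide p by r: the remainder is a smaller multiple of f, hence in
   P, so the quotient s is in P, and being small it vanishes over D / D0, as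
   does then p. *)
have sz1 : (size r <= 1)%N.
  rewrite leqNgt; apply/negP => lt1r.
  have := Pdiv.ComRing.rdivp_eq r p; have := Pdiv.CommonRing.ltn_rmodpN0 p r0.
  have := Pdiv.CommonRing.leq_rdivp p r.
  set m := Pdiv.CommonRing.rscalp p r.
  set s := Pdiv.CommonRing.rdivp p r.
  set r' := Pdiv.CommonRing.rmodp p r => le_sp lt_r' eqp.
  set b := lead_coef r in Pb eqp.
  have Pr' : r' \in P.
    apply: contrapT => /negP Pr'; move: lt_r'; rewrite ltnNge rmin //.
    split=> //; exists (- (s * v)).
    have -> : r' - - (s * v) * f = (b ^+ m)%:P * p - s * (r - v * f).
      rewrite mul_polyC eqp mulNr opprK mulrBr opprB mulrA.
      by rewrite [s * r + r']addrC -addrA [s * r + _]addrCA subrr addr0.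
    by apply: PB; apply: PM.
  have Ps : s \in P.
    have /Pprime[//|] : s * r \in P by rewrite -(addrK r' (s * r)) -eqp -mul_polyC;
      apply: PB => //; apply: PM.
    by rewrite (negPf Pr).
  have Ns : coefs_in s.
    have [s0 i|s0] := eqVneq s 0; first by rewrite s0 coef0.
    have [|ge_sp] := ltnP (size s) (size p); first exact: small.
    have ls : (lead_coef s)%:P \in P.
      suff h : lead_coef s * b = 0.
        have /Pprime[//|] : (lead_coef s)%:P * b%:P \in P by rewrite -polyCM h.
        by rewrite (negPf Pb).
      rewrite mul_lead_coef -[s * r](addrK r') -eqp coefB coefZ.
      have le_p : (size p <= (size s + size r).-2)%N.
        by move: lt1r; case: (size r) => [|[|n]] // _; rewrite !addnS /= (leq_trans ge_sp) ?leq_addr.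
      rewrite !nth_default ?mulr0 ?subrr //.
      by apply: leq_trans le_p; apply: ltnW; apply: ltn_trans lt_rp.
    rewrite -(subrK (trunc s) s); apply: (coefs_inD (coefs_trunc ls)).
    by apply: small; [rewrite trunc_P|apply: leq_trans (size_trunc s0) le_sp].
  have : coefs_in (s * r + r').
    apply: coefs_inD; last by apply: small => //; apply: ltn_trans lt_rp.
    move=> i; rewrite coefM rmorph_sum /=; apply: ideal_sum => // j _.
    by rewrite polyCM mulrC; apply: PM.
  move=> /(_ (size p).-1); rewrite -eqp coefZ -lead_coefE polyCM => /Pprime[].
    by apply/negP/Ppow.
  exact/negP.
have er := size1_polyC sz1; set d := r`_0 in er.
have Pd : d%:P \notin P by rewrite -er.
exists (a * d) => [|e eP].
  by apply/negP; rewrite polyCM => /Pprime[]; apply/negP.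
rewrite rmorphM mulf_eq0 => /norP[ea ed].
have sz_ep : size (map_poly e p) = size p by apply: size_map_poly_id0.
have /closed_rootP[x /rootP px] : size (map_poly e p) != 1.
  rewrite sz_ep; apply/negP => /eqP sz_p; move/negP: Pa; apply.
  by rewrite /a lead_coefE sz_p /= -size1_polyC ?sz_p.
have Px q : q \in P -> (map_poly e q).[x] = 0.
  move=> Pq; have eqq := Pdiv.ComRing.rdivp_eq p q.
  set m := Pdiv.CommonRing.rscalp q p in eqq.
  set t := Pdiv.CommonRing.rdivp q p in eqq.
  have lt_q' := Pdiv.CommonRing.ltn_rmodpN0 q p0.
  set q' := Pdiv.CommonRing.rmodp q p in eqq lt_q'.
  have eqq' : q' = (a ^+ m)%:P * q - t * p by rewrite mul_polyC eqq addrC addKr.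
  have Nq' : coefs_in q'.
    by apply: small => //; rewrite eqq'; apply: PB; apply: PM.
  have := congr1 (fun q => (map_poly e q).[x]) eqq'.
  rewrite (map0 e) // horner0 rmorphB !rmorphM /= map_polyC hornerD hornerN.
  rewrite !hornerM px mulr0 subr0 hornerC => /esym/eqP.
  rewrite mulf_eq0 => /orP[eam|/eqP//].
  by have /negP[] := expf_neq0 m ea; rewrite -rmorphXn.
exists x; split=> //; apply: contraNneq ed => fx.
have := Px _ Pvf; rewrite rmorphB rmorphM /= hornerD hornerN hornerM fx mulr0 subr0.
by rewrite er map_polyC hornerC => ->.
Qed.

End OneVariable.

(** Points extend from D to a ring generated by finitely many elements over the
image of D, outside the zero set of some d; the induction on the generators
replaces D by D[X]. *)
Lemma extend_finitely_generated (k : closedFieldType) (R : comNzRingType)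
    (P : {pred R}) : prime_two_sided_ideal P ->
  forall (s : seq R) (D : comNzRingType) (j : {rmorphism D -> R}),
  (forall S : {pred R}, subring_closed S -> (forall x, j x \in S) ->
     {subset s <= S} -> S =i predT) ->
  forall f, f \notin P -> exists2 d, j d \notin P &
  forall e : {rmorphism D -> k}, (forall x, j x \in P -> e x = 0) -> e d != 0 ->
  exists e' : {rmorphism R -> k},
    [/\ forall x, e' (j x) = e x, forall x, x \in P -> e' x = 0 & e' f != 0].
Proof.
move=> prP; have [[idP _] _] := prP.
elim=> [|x s IH] D j genR f Pf.
  have js y : exists x, j x = y.
    pose S : {pred R} := [pred y | `[< exists x, j x = y >]].
    have SP z : reflect (exists x, j x = z) (z \in S) by apply: asboolP.
    have : y \in S; last by move/SP.
    rewrite genR //; last by move=> z; apply/SP; exists z.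
    split; first by apply/SP; exists 1; rewrite rmorph1.
      by move=> _ _ /SP[u <-] /SP[v <-]; apply/SP; exists (u - v); rewrite rmorphB.
    by move=> _ _ /SP[u <-] /SP[v <-]; apply/SP; exists (u * v); rewrite rmorphM.
  have [h hK] := choice js.
  exists (h f) => [|e eP ef]; first by rewrite hK.
  have ej u v : j u = j v -> e u = e v.
    move=> uv; apply/eqP; rewrite -subr_eq0 -rmorphB eP //.
    by rewrite rmorphB uv subrr; apply: ideal0.
  pose e' y := e (h y).
  have e'B : zmod_morphism e'.
    by move=> u v; rewrite /e' -rmorphB; apply: ej; rewrite rmorphB !hK.
  have e'M : monoid_morphism e'.
    split=> [|u v]; first by rewrite -(rmorph1 e); apply: ej; rewrite rmorph1 hK.
    by rewrite /e' -rmorphM; apply: ej; rewrite rmorphM !hK.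
  pose fB := GRing.isZmodMorphism.Build R k e' e'B.
  pose fM := GRing.isMonoidMorphism.Build R k e' e'M.
  pose E : {rmorphism R -> k} := HB.pack e' fB fM.
  exists E; split=> [y|y Py|] //=; first by apply: ej; rewrite hK.
  by apply: eP; rewrite hK.
have cjx : commr_rmorph j x by move=> y; apply: mulrC.
pose j' : {rmorphism {poly D} -> R} := horner_morph cjx.
have j'C a : j' a%:P = j a by apply: horner_morphC.
have j'X : j' 'X = x by apply: horner_morphX.
have [|F PF hF] := IH {poly D} j' _ f Pf.
  move=> S Sring jS sS; apply: genR => // [y|y]; first by rewrite -j'C.
  by rewrite inE => /orP[/eqP->|/sS//]; rewrite -j'X.
pose P' : {pred {poly D}} := [pred q | j' q \in P].
have prP' : prime_two_sided_ideal P'.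
  apply: prime_comm_intro.
  - case: idP => -[P0 PB] PM; split; first split; rewrite ?inE ?rmorph0 //.
      by move=> u v; rewrite !inE rmorphB; apply: PB.
    by move=> a u; rewrite !inE !rmorphM; apply: PM.
  - by rewrite inE rmorph1; apply: proper1; case: prP.
  - by move=> a b; rewrite !inE rmorphM; apply: prime_comm.
have [d Pd hd] := extend_one_variable k prP' (PF : F \notin P').
exists d => [|e eP ed]; first by move: Pd; rewrite inE j'C.
have [|y [yP yF]] := hd e _ ed; first by move=> a; rewrite inE j'C; apply: eP.
have cey : commr_rmorph e y by move=> z; apply: mulrC.
have [q Pq|//|e' [e'j e'P e'f]] := hF (horner_morph cey); first exact: yP.
by exists e'; split=> // a; rewrite -j'C e'j; apply: horner_morphC.
Qed.

(** The case D = k of the extension lemma, where the condition on d is void. *)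
Lemma Nullstellensatz (k : closedFieldType) (R : comAlgType k) (P : {pred R})
    (f : R) : affine R -> prime_two_sided_ideal P -> f \notin P ->
  exists e : {rmorphism R -> k},
    [/\ forall a, e a%:A = a, forall x, x \in P -> e x = 0 & e f != 0].
Proof.
move=> [s gens] prP Pf; have P1 : 1 \notin P by apply: proper1; case: prP.
have [|d Pd hd] := @extend_finitely_generated k R P prP s k (GRing.in_alg R) _ f Pf.
  move=> S [S1 SB SM] Sk sS; apply: gens => //; split=> // a u v Su Sv.
  rewrite -mulr_algl -[v]opprK; apply: (SB); first by apply: SM; first exact: Sk.
  by rewrite -sub0r -(subrr 1); apply: (SB) => //; apply: (SB).
have eP (a : k) : a%:A \in P -> a = 0.
  move=> Pa; apply/eqP; apply: contraNT P1 => a0.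
  case: prP => -[[_ PM] _] _; have [+ _] := PM (a^-1)%:A _ Pa.
  by rewrite -scalerAl mul1r scalerA mulVf // scale1r.
have [|e' [e'k e'P e'f]] := hd (idfun : {rmorphism k -> k}) eP _.
  by apply/eqP => /= d0; move: Pd; rewrite /= d0 scale0r ideal0 //; case: prP => -[].
by exists e'; split=> // a; apply: e'k.
Qed.

(** * Weighted sums of homogeneous components *)

(** The operator wt w multiplies the component of each degree g by w g.
Projections to components, automorphisms given by characters and rescalings
are all of this form, and they compose by multiplication of the weights. *)
Section Weights.
Variables (k : fieldType) (G : zmodType) (R : comAlgType k) (RG : G -> {pred R}).
Implicit Types (r s : R) (g h : G) (w : G -> k) (l : seq G).

Definition decomposes r (d : seq G * (G -> R)) :=
  [/\ uniq d.1, forall g, d.2 g \in RG g & r = \sum_(g <- d.1) d.2 g].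

Definition decomposition r := xget ([::], fun=> 0) [set d | decomposes r d].

Definition wt w r :=
  let d := decomposition r in \sum_(g <- d.1) w g *: d.2 g.

Definition component g r := wt (fun h => (h == g)%:R) r.

Hypothesis gr : grading RG.

Let RG0 g : 0 \in RG g. Proof. by case: gr => /(_ g)[]. Qed.
Let RGl g a r s : r \in RG g -> s \in RG g -> a *: r + s \in RG g.
Proof. by case: gr => /(_ g)[_ h] _ _ _ ? ?; apply: h. Qed.
Lemma homogeneousZ g a r : r \in RG g -> a *: r \in RG g.
Proof. by move=> hr; rewrite -[_ *: _]addr0; apply: RGl. Qed.
Lemma homogeneousD g r s : r \in RG g -> s \in RG g -> r + s \in RG g.
Proof. by move=> hr; rewrite -[r]scale1r; apply: RGl; rewrite ?scale1r. Qed.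
Lemma homogeneousM g h r s : r \in RG g -> s \in RG h -> r * s \in RG (g + h).
Proof. by case: gr => _ RGM _ _; apply: RGM. Qed.

Lemma big_uniq_extend (V : zmodType) l t (f : G -> V) :
  uniq l -> uniq t -> {subset l <= t} ->
  \sum_(g <- l) f g = \sum_(g <- t) if g \in l then f g else 0.
Proof.
move=> Ul Ut lt; rewrite -big_mkcond -big_filter; apply: perm_big.
apply: uniq_perm => //; first exact: filter_uniq.
by move=> g; rewrite mem_filter; case: (boolP (g \in l)) => // /lt.
Qed.

Lemma decomposition2 r s : exists l (f f' : G -> R),
  [/\ uniq l, forall g, f g \in RG g, forall g, f' g \in RG g,
      r = \sum_(g <- l) f g & s = \sum_(g <- l) f' g].
Proof.
have dec1 u : exists l (f : G -> R),
    [/\ uniq l, forall g, f g \in RG g & u = \sum_(g <- l) f g].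
  case: gr => _ _ /(_ u)[l [f [fG ->]]] _.
  exists (undup l), (fun g => f g *+ count_mem g l); split=> [|g|].
  - exact: undup_uniq.
  - by rewrite -scaler_nat; apply: homogeneousZ.
  - rewrite -big_undup_iterop_count; apply: eq_bigr => g _.
    by rewrite Monoid.iteropE; elim: (count_mem g l) => //= n IH; rewrite mulrS IH.
have [l [f [Ul fG ->]]] := dec1 r; have [l' [f' [Ul' f'G ->]]] := dec1 s.
exists (undup (l ++ l')), (fun g => if g \in l then f g else 0),
   (fun g => if g \in l' then f' g else 0).
have Ut := undup_uniq (l ++ l').
split=> // [g|g||].
- by case: ifP.
- by case: ifP.
- by apply: big_uniq_extend => // g gl; rewrite mem_undup mem_cat gl.
- by apply: big_uniq_extend => // g gl; rewrite mem_undup mem_cat gl orbT.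
Qed.

Lemma decompositionP r : decomposes r (decomposition r).
Proof.
apply: (@xgetPex _ ([::], fun=> 0) [set d | decomposes r d]).
by have [l [f [_ [Ul fG _ rE _]]]] := decomposition2 r r; exists (l, f).
Qed.

Lemma wtE w l (f : G -> R) : uniq l -> (forall g, f g \in RG g) ->
  wt w (\sum_(g <- l) f g) = \sum_(g <- l) w g *: f g.
Proof.
move=> Ul fG; rewrite /wt; set r := \sum_(g <- l) f g.
have [] := decompositionP r; set l' := (decomposition r).1.
set f' := (decomposition r).2 => Ul' f'G rE.
pose t := undup (l ++ l'); have Ut : uniq t := undup_uniq _.
have lt : {subset l <= t} by move=> g gl; rewrite mem_undup mem_cat gl.
have lt' : {subset l' <= t} by move=> g gl; rewrite mem_undup mem_cat gl orbT.
pose d g := (if g \in l then f g else 0) - (if g \in l' then f' g else 0).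
have dG g : d g \in RG g.
  rewrite /d addrC -scaleN1r; apply: RGl; by case: ifP.
have d0 : {in t, forall g, d g = 0}.
  case: gr => _ _ _; apply=> //; rewrite sumrB -!big_uniq_extend //.
  by rewrite -rE subrr.
rewrite (big_uniq_extend _ Ul' Ut lt') (big_uniq_extend _ Ul Ut lt).
rewrite !big_seq; apply: eq_bigr => g gt.
have := d0 g gt; rewrite /d; do 2!case: ifP => _; rewrite ?subr0 ?sub0r => /eqP.
- by rewrite subr_eq0 => /eqP ->.
- by move=> /eqP ->; rewrite scaler0.
- by rewrite oppr_eq0 => /eqP ->; rewrite scaler0.
- by [].
Qed.

Lemma wt_linear w : linear (wt w).
Proof.
move=> a r s; have [l [f [f' [Ul fG f'G -> ->]]]] := decomposition2 r s.
rewrite scaler_sumr -big_split /= !wtE // => [|g]; last exact: RGl.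
rewrite scaler_sumr -big_split /=; apply: eq_bigr => g _.
by rewrite scalerDr !scalerA mulrC.
Qed.

Lemma wtD w r s : wt w (r + s) = wt w r + wt w s.
Proof. by rewrite -[r]scale1r wt_linear !scale1r. Qed.
Lemma wt0 w : wt w 0 = 0.
Proof. by apply: (addrI (wt w 0)); rewrite -wtD !addr0. Qed.
Lemma wtZ w a r : wt w (a *: r) = a *: wt w r.
Proof. by rewrite -[a *: r]addr0 wt_linear wt0 addr0. Qed.
Lemma wtB w r s : wt w (r - s) = wt w r - wt w s.
Proof. by rewrite wtD -scaleN1r wtZ scaleN1r. Qed.

Lemma wt_homogeneous w g r : r \in RG g -> wt w r = w g *: r.
Proof.
move=> rG; pose f h := if h == g then r else 0.
have <- : \sum_(h <- [:: g]) f h = r by rewrite big_seq1 /f eqxx.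
rewrite wtE // => [|h]; first by rewrite !big_seq1.
by rewrite /f; case: eqP => // ->.
Qed.

Lemma wt_wt w w' r : wt w (wt w' r) = wt (fun g => w g * w' g) r.
Proof.
have [l [f [_ [Ul fG _ -> _]]]] := decomposition2 r r.
rewrite !wtE // => [|g]; last exact: homogeneousZ.
by apply: eq_bigr => g _; rewrite scalerA.
Qed.

Lemma wt_add w w' r : wt (fun g => w g + w' g) r = wt w r + wt w' r.
Proof. by rewrite /wt -big_split /=; apply: eq_bigr => g _; rewrite scalerDl. Qed.

Lemma wt_scale a w r : wt (fun g => a * w g) r = a *: wt w r.
Proof. by rewrite /wt scaler_sumr; apply: eq_bigr => g _; rewrite scalerA. Qed.

Lemma wt_ext w w' r : w =1 w' -> wt w r = wt w' r.
Proof. by move=> ww'; apply: eq_bigr => g _; rewrite ww'. Qed.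

Lemma wt_const a r : wt (fun=> a) r = a *: r.
Proof.
have [l [f [_ [Ul fG _ -> _]]]] := decomposition2 r r.
by rewrite wtE // scaler_sumr.
Qed.

Definition supported l r :=
  forall w w', {in l, w =1 w'} -> wt w r = wt w' r.

Lemma exists_support r : exists l, supported l r.
Proof.
exists (decomposition r).1 => w w' ww'; rewrite /wt !big_seq.
by apply: eq_bigr => g /ww' ->.
Qed.

(** This makes the length of a support decrease in the inductions below. *)
Lemma wt_supported_rem l g w r : supported l r -> w g = 0 ->
  supported [seq h <- l | h != g] (wt w r).
Proof.
move=> lr wg w1 w2 w12; rewrite !wt_wt; apply: lr => h hl.
have [->|hg] := eqVneq h g; first by rewrite wg !mulr0.
by rewrite w12 // mem_filter /= hg.
Qed.

Lemma supported_nil r : supported [::] r -> r = 0.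
Proof.
move=> r0; rewrite -[r]scale1r -wt_const (r0 (fun=> 1) (fun=> 0)) //.
by rewrite wt_const scale0r.
Qed.

Lemma component_homogeneous g r : component g r \in RG g.
Proof.
have [l [f [_ [Ul fG _ -> _]]]] := decomposition2 r r.
rewrite /component wtE //; elim/big_rec: _ => // h s _ IH.
by apply: homogeneousD => //; case: eqP => [->|_]; rewrite ?scale1r ?scale0r.
Qed.

Lemma sum_components r : exists2 l, uniq l & r = \sum_(g <- l) component g r.
Proof.
have [l [f [_ [Ul fG _ -> _]]]] := decomposition2 r r.
exists l => //; apply: eq_big_seq => g gl.
rewrite /component wtE // (bigD1_seq g) //= eqxx scale1r big1 ?addr0 //.
by move=> h /negPf ->; rewrite scale0r.
Qed.

Lemma homogeneous_ind (K : R -> Prop) :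
  K 0 -> (forall r s, K r -> K s -> K (r + s)) ->
  (forall g r, r \in RG g -> K r) -> forall r, K r.
Proof.
move=> K0 KD Kh r; have [l _ ->] := sum_components r.
by elim/big_ind: _ => // g _; apply: (Kh g); apply: component_homogeneous.
Qed.

Lemma wt_homogeneousM w g r s : r \in RG g ->
  wt w (r * s) = r * wt (fun h => w (g + h)) s.
Proof.
move=> rG; elim/homogeneous_ind: s => [|u v IHu IHv|h s sG].
- by rewrite mulr0 !wt0 mulr0.
- by rewrite mulrDr !wtD IHu IHv mulrDr.
- rewrite (wt_homogeneous _ (homogeneousM rG sG)) (wt_homogeneous _ sG).
  by rewrite scalerAr.
Qed.

Lemma wtM w r s : (forall g h, w (g + h) = w g * w h) ->
  wt w (r * s) = wt w r * wt w s.
Proof.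
move=> wD; elim/homogeneous_ind: r => [|u v IHu IHv|h r rG].
- by rewrite mul0r wt0 mul0r.
- by rewrite mulrDl !wtD IHu IHv mulrDl.
- rewrite (wt_homogeneousM _ _ rG) (wt_homogeneous _ rG) -scalerAl.
  by rewrite scalerAr -wt_scale; congr (_ * _); apply: wt_ext.
Qed.

(** For r of degree g, the component of degree g of r = r * 1 is r times the
component of 1 of degree 0, so the latter is a unit element. *)
Lemma component1 : component 0 1 = 1.
Proof.
set e := component 0 1.
have eG : e \in RG 0 by apply: component_homogeneous.
suff e1 r : r * e = r by rewrite -[e]mul1r e1.
elim/homogeneous_ind: r => [|u v IHu IHv|g r rG]; first by rewrite mul0r.
  by rewrite mulrDl IHu IHv.
have := wt_homogeneousM (fun h => (h == g)%:R) 1 rG.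
rewrite mulr1 (wt_homogeneous _ rG) eqxx scale1r => {2}->; congr (_ * _).
by apply: wt_ext => h; rewrite -{2}[g]addr0 (inj_eq (addrI g)).
Qed.

Lemma homogeneous1 : 1 \in RG 0.
Proof. by rewrite -component1 component_homogeneous. Qed.

Lemma componentM g r s : exists l,
  component g (r * s) = \sum_(h <- l) component h r * component (g - h) s.
Proof.
have [l _ rE] := sum_components r; exists l.
rewrite [in LHS]rE mulr_suml.
have wt_sum (F : G -> R) : component g (\sum_(h <- l) F h) = \sum_(h <- l) component g (F h).
  by apply: (big_morph (component g)) => [u v|]; rewrite /component ?wtD ?wt0.
rewrite wt_sum; apply: eq_bigr => h _.
rewrite /component (wt_homogeneousM _ _ (component_homogeneous h r)); congr (_ * _).
by apply: wt_ext => h'; rewrite -[h' == _]subr_eq0 opprB addrA [h' + h]addrC subr_eq0.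
Qed.

Lemma componentD g r s : component g (r + s) = component g r + component g s.
Proof. exact: wtD. Qed.
Lemma componentZ g a r : component g (a *: r) = a *: component g r.
Proof. exact: wtZ. Qed.

End Weights.

(** * Normalization of the cocycle *)

Lemma closed_field_root (k : closedFieldType) (x : k) n :
  exists y, y ^+ n.+1 = x.
Proof.
have /closed_rootP[y] : size ('X^(n.+1) - x%:P) != 1 by rewrite size_XnsubC.
by rewrite /root !hornerE subr_eq0 => /eqP <-; exists y.
Qed.

Section SquareRoots.
Variable k : closedFieldType.

(** The group C contains a square root of each of its elements, and exactly one
because the only square root of 1 in C is 1. *)
Definition square_root_group (C : {pred k}) :=
  [/\ divr_closed C, 0 \notin C, forall x, x \in C -> exists2 y, y \in C & y ^+ 2 = x
    & forall x, x \in C -> x ^+ 2 = 1 -> x = 1].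

(** Take C maximal among the groups that contain H but not -1.  If x ^+ 2 is in
C, then x or - x is in C: otherwise C together with its coset of x would be a
larger group without -1. *)
Lemma square_root_group_above (H : {pred k}) :
  divr_closed H -> 0 \notin H -> -1 \notin H ->
  exists2 C, square_root_group C & {subset H <= C}.
Proof.
move=> [H1 HV] H0 HN.
pose S (x : k) := x = 0 \/ x = -1; pose op (_ : unit) (x y : k) := x / y.
have [||C [[C1 Cop] HC CS Cmax]] := @maximal_operation_closed k 1 unit op S H.
- by split=> // _ x y; apply: HV.
- by move=> x [] ->.
have CV x y : x \in C -> y \in C -> x / y \in C by apply: (Cop tt).
have Ci x : x \in C -> x^-1 \in C by move=> Cx; rewrite -div1r; apply: CV.
have CM x y : x \in C -> y \in C -> x * y \in C.
  by move=> Cx Cy; rewrite -[y]invrK; apply: CV => //; apply: Ci.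
have C0 : 0 \notin C by apply: CS; left.
have CN : -1 \notin C by apply: CS; right.
exists C => //; split=> //; last first.
  move=> x Cx /eqP; rewrite sqrf_eq1 => /orP[/eqP//|/eqP xN].
  by move: CN; rewrite -xN Cx.
move=> b Cb; have [x xb] := closed_field_root b 1.
have x0 : x != 0.
  by apply: contraNneq C0 => x0; rewrite x0 expr0n in xb; rewrite [0]xb.
pose C' : {pred k} := [pred y | (y \in C) || (y / x \in C)].
have [CxN|CxN] := boolP (- x^-1 \in C).
  exists (- x); last by rewrite sqrrN.
  by rewrite -[- x]invrK invrN; apply: Ci.
exists x => //; apply: (Cmax C'); last by rewrite inE divff ?C1 ?orbT.
- split; first by rewrite inE C1.
  move=> [] y z; rewrite !inE /op => /orP[Cy|Cy] /orP[Cz|Cz]; apply/orP.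
  + by left; apply: CV.
  + right; rewrite (_ : _ / x = y / (z / x) / b); first by apply: (CV) => //; apply: (CV).
    rewrite -xb invf_div expr2 invfM !mulrA; congr (_ / x).
    by rewrite (ACl (1*3*(2*4))) /= divff // mulr1.
  + by right; rewrite mulrAC; apply: CV.
  + left; rewrite (_ : y / z = (y / x) / (z / x)); first exact: CV.
    by rewrite invf_div mulrA divfK.
- by move=> y Cy; rewrite inE Cy.
- move=> y [] ->; rewrite inE negb_or.
    by rewrite mul0r C0.
  by rewrite CN mulN1r.
Qed.

Lemma square_root_group_char2 : 2%N \in [pchar k] ->
  square_root_group [pred x | x != 0].
Proof.
move=> k2; split; rewrite ?inE ?eqxx //.
- split; rewrite ?inE ?oner_eq0 // => x y; rewrite !inE => x0 y0.
  by rewrite mulf_neq0 // invr_eq0.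
- move=> x x0; have [y yx] := closed_field_root x 1.
  by exists y => //; rewrite inE; apply: contraNneq x0 => y0; rewrite -yx y0 expr0n.
- move=> x _ /eqP; rewrite sqrf_eq1 => /orP[/eqP//|/eqP ->].
  by rewrite oppr_pchar2.
Qed.

Lemma square_root_hom (C : {pred k}) : square_root_group C ->
  exists f : k -> k, [/\ {in C, forall x, f x \in C},
    {in C, forall x, f x ^+ 2 = x} & {in C &, {morph f : x y / x * y}}].
Proof.
move=> [[C1 CV] C0 Csqrt Cuniq].
have Ci x : x \in C -> x^-1 \in C by move=> Cx; rewrite -div1r; apply: CV.
have CM x y : x \in C -> y \in C -> x * y \in C.
  by move=> Cx Cy; rewrite -[y]invrK; apply: CV => //; apply: Ci.
have /choice[f hf] : forall x, exists y, x \in C -> y \in C /\ y ^+ 2 = x.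
  move=> x; have [Cx|Cx] := boolP (x \in C); last by exists 0.
  by have [y Cy yx] := Csqrt x Cx; exists y.
have fC x (Cx : x \in C) := (hf x Cx).1; have f2 x (Cx : x \in C) := (hf x Cx).2.
exists f; split=> // x y Cx Cy.
have Cf := CM _ _ (fC _ Cx) (fC _ Cy).
have nz z : z \in C -> z != 0 by move=> Cz; apply: contraNneq C0 => <-.
apply: (mulIf (nz _ (Ci _ Cf))); rewrite divff ?nz //.
apply: Cuniq; first by apply: CV => //; apply: fC; apply: CM.
by rewrite expr_div_n exprMn !f2 ?CM // divff // nz // CM.
Qed.

End SquareRoots.

(** A subgroup C maximal among those meeting D trivially is a complement.  Given
e, divisibility of D allows one to subtract some w of D so that no multiple of
e - w falls in C + D without falling in C; then C and e - w generate a group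
that still meets D trivially, so e - w is in C. *)
Lemma divisible_complement (E : zmodType) (D : {pred E}) : zmod_closed D ->
  (forall x n, x \in D -> exists2 y, y \in D & y *+ n.+1 = x) ->
  exists C : {pred E}, [/\ zmod_closed C, forall x, x \in C -> x \in D -> x = 0 &
    forall x, exists2 y, y \in C & x - y \in D].
Proof.
move=> [D0 DB] Ddiv; pose S x := x \in D /\ x != 0.
pose op (v : void) (x : E) := x.
have [||C [[[C0 CB] _] _ CS Cmax]] := @maximal_stable_subgroup E void op S (pred1 0).
- split; last by case.
  by split; rewrite ?inE // => x y; rewrite !inE => /eqP-> /eqP->; rewrite subr0.
- by move=> x [].
have DN x : x \in D -> - x \in D by move=> ?; rewrite -sub0r DB.
have CN x : x \in C -> - x \in C by move=> ?; rewrite -sub0r CB.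
have DD x y : x \in D -> y \in D -> x + y \in D.
  by move=> ? Dy; rewrite -[y]opprK DB // DN.
have CD x y : x \in C -> y \in C -> x + y \in C.
  by move=> ? Dy; rewrite -[y]opprK CB // CN.
have Dint x (m : int) : x \in D -> x *~ m \in D.
  move=> Dx; have Dn n : x *+ n \in D.
    by elim: n => [|n IH]; rewrite ?mulr0n // mulrS DD.
  by case: m => n; [exact: Dn|rewrite NegzE mulrNz; apply/DN/Dn].
have Cint x (m : int) : x \in C -> x *~ m \in C.
  move=> Cx; have Cn n : x *+ n \in C.
    by elim: n => [|n IH]; rewrite ?mulr0n // mulrS CD.
  by case: m => n; [exact: Cn|rewrite NegzE mulrNz; apply/CN/Cn].
have CDI x : x \in C -> x \in D -> x = 0.
  move=> Cx Dx; apply/eqP/negPn/negP => x0.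
  by have /negP[] := CS x (conj Dx x0).
exists C; split=> // e; pose B x := exists2 y, y \in C & x - y \in D.
have BN x : B x -> B (- x).
  by move=> [y Cy Dxy]; exists (- y); rewrite ?CN // -opprD DN.
have BD x y : B x -> B y -> B (x + y).
  move=> [u Cu Dxu] [v Cv Dyv]; exists (u + v); first exact: CD.
  by rewrite opprD addrACA DD.
have BC x : x \in C -> B x by exists x; rewrite ?subrr.
have BDD x : x \in D -> B x by exists 0; rewrite ?subr0.
suff [w Dw hw] : exists2 w, w \in D & forall m : int, B ((e - w) *~ m) -> (e - w) *~ m \in C.
  exists (e - w); last by rewrite opprB addrC subrK.
  pose C' : {pred E} := [pred x | `[< exists m : int, x - (e - w) *~ m \in C >]].
  have C'P x : reflect (exists m : int, x - (e - w) *~ m \in C) (x \in C').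
    exact: asboolP.
  apply: (Cmax C'); last by apply/C'P; exists 1; rewrite mulr1z subrr.
  - split; last by case.
    split; first by apply/C'P; exists 0; rewrite subrr.
    move=> x y /C'P[m hm] /C'P[n hn]; apply/C'P; exists (m - n).
    have -> : x - y - (e - w) *~ (m - n) = x - (e - w) *~ m - (y - (e - w) *~ n).
      by rewrite mulrzBr !opprB addrACA [- y + _]addrC addrACA.
    exact: CB.
  - by move=> x Cx; apply/C'P; exists 0; rewrite subr0.
  move=> x [Dx x0]; apply/negP => /C'P[m hm]; case/eqP: x0; apply: CDI => //.
  rewrite -(subrK ((e - w) *~ m) x); apply: CD => //; apply: hw.
  by rewrite -[_ *~ m](subKr x); apply: BD; [exact: BDD|exact/BN/BC].
(* B is C + D.  If no positive multiple of e is in B, take w = 0; otherwise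
   adjust e by dividing, in D, the D-component of its least multiple in B. *)
have [[n Bn]|no] := pselect (exists n, B (e *+ n.+1)); last first.
  exists 0 => // m; rewrite subr0 => Bm.
  case: m Bm => [[|n]|n] Bm; first by rewrite mulr0z.
    by case: no; exists n.
  by case: no; exists n; move: (BN _ Bm); rewrite NegzE mulrNz opprK.
have [|{Bn}n [c Cc Dc] nmin] := @exists_minimizer nat id (fun n => B (e *+ n.+1)).
  by exists n.
have [w Dw wn] := Ddiv _ n Dc; exists w => // m Bm.
have en : (e - w) *+ n.+1 = c by rewrite mulrnBl wn opprB addrC subrK.
have em : (e - w) *~ m = c *~ (m %/ n.+1)%Z + (e - w) *~ (m %% n.+1)%Z.
  by rewrite {1}(divz_eq m n.+1) mulrzDr mulrC mulrzA -pmulrn en.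
have : (0 <= (m %% n.+1)%Z < n.+1)%R by rewrite modz_ge0 // ltz_pmod.
case: (m %% n.+1)%Z em => // -[|r] em /andP[_ lt_r].
  by rewrite em mulr0z addr0 Cint.
suff /nmin : B (e *+ r.+1) by move: lt_r; rewrite ltz_nat ltnS ltnNge => /negP.
rewrite -[e](subrK w) mulrnDl; apply: (BD); last first.
  by apply: BDD; rewrite pmulrn; apply: Dint.
have -> : (e - w) *+ r.+1 = (e - w) *~ m - c *~ (m %/ n.+1)%Z.
  by rewrite em pmulrn addrAC subrr add0r.
by apply: (BD) => //; apply/BN/BC/Cint.
Qed.

Section Extension.
Variables (k : fieldType) (G : zmodType) (d : G -> G -> k).

Definition symmetric_cocycle := two_cocycle d /\ forall a b, d a b = d b a.

Hypothesis hd : symmetric_cocycle.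

Let dn0 a b : d a b != 0. Proof. by case: hd => -[]. Qed.
Let dA a b e : d a b * d (a + b) e = d b e * d a (b + e).
Proof. by case: hd => -[]. Qed.
Let dC a b : d a b = d b a. Proof. by case: hd. Qed.
Let d0 a : d 0 a = d 0 0.
Proof. by apply: (mulfI (dn0 0 a)); have := dA 0 0 a; rewrite !add0r mulrC => <-. Qed.

(** The abelian extension of G by the multiplicative group of k with cocycle d,
written additively; its zero has first coordinate (d 0 0)^-1 since d need not be
normalized. *)
Definition extension (_ : symmetric_cocycle) := {x : k * G | x.1 != 0}.
Local Notation E := (extension hd).

HB.instance Definition _ := Choice.on E.

Definition ext_add (x y : E) : E :=
  exist _ ((val x).1 * (val y).1 * d (val x).2 (val y).2, (val x).2 + (val y).2)
    (mulf_neq0 (mulf_neq0 (valP x) (valP y)) (dn0 _ _)).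

Definition ext_zero : E := exist _ ((d 0 0)^-1, 0) (invr_neq0 (dn0 0 0)).

Definition ext_opp (x : E) : E :=
  exist _ (((val x).1 * d (val x).2 (- (val x).2) * d 0 0)^-1, - (val x).2)
    (invr_neq0 (mulf_neq0 (mulf_neq0 (valP x) (dn0 _ _)) (dn0 0 0))).

Lemma ext_addA : associative ext_add.
Proof.
move=> [[x a] hx] [[y b] hy] [[z e] hz]; apply: val_inj => /=; congr pair.
  by rewrite [RHS](ACl (1*2*4*(3*5))) /= dA !mulrA.
exact: addrA.
Qed.

Lemma ext_addC : commutative ext_add.
Proof.
move=> [[x a] hx] [[y b] hy]; apply: val_inj => /=.
by rewrite [x * y]mulrC dC addrC.
Qed.

Lemma ext_add0 : left_id ext_zero ext_add.
Proof.
move=> [[x a] hx]; apply: val_inj => /=.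
by rewrite d0 add0r mulrAC mulVf // mul1r.
Qed.

Lemma ext_addN : left_inverse ext_zero ext_opp ext_add.
Proof.
move=> [[x a] /= hx]; apply: val_inj => /=.
rewrite [d (- a) a]dC addNr; congr pair.
by rewrite -mulrA mulrC invfM mulrA divff ?mul1r // mulf_neq0.
Qed.

HB.instance Definition _ :=
  GRing.isZmodule.Build E ext_addA ext_addC ext_add0 ext_addN.
End Extension.

(** The multiplicative group of an algebraically closed field is divisible, so
the extension of G defined by d splits; m is the first coordinate of a
splitting. *)
Lemma symmetric_cocycle_coboundary (k : closedFieldType) (G : zmodType)
    (d : G -> G -> k) : symmetric_cocycle d ->
  exists2 m : G -> k, forall a, m a != 0 &
    forall a b, m (a + b) = m a * m b * d a b.
Proof.
move=> hd; have dn0 a b : d a b != 0 by case: hd => -[].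
pose E := extension hd.
pose deg (x : E) : G := (val x).2; pose D : {pred E} := [pred x : E | deg x == 0].
have degD (x y : E) : deg (x + y) = deg x + deg y by [].
have degN (x : E) : deg (- x) = - deg x by [].
have degB (x y : E) : deg (x - y) = deg x - deg y by [].
have [||C [[C0 CB] CDI CE]] := @divisible_complement E D.
- by split; rewrite ?inE // => x y; rewrite !inE degB => /eqP-> /eqP->; rewrite subrr.
- move=> x n; rewrite inE => /eqP x0.
  have [y yx] := closed_field_root ((val x).1 / d 0 0 ^+ n) n.
  have y0 : y != 0.
    apply: contraTneq (valP x) => y0; rewrite /= negbK.
    move: yx; rewrite y0 expr0n /= => /esym/eqP.
    by rewrite mulf_eq0 invr_eq0 expf_eq0 (negPf (dn0 0 0)) andbF orbF.
  pose u : E := exist _ (y, 0) y0; exists u; first by rewrite inE.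
  have un m : val (u *+ m.+1) = (y ^+ m.+1 * d 0 0 ^+ m, 0).
    elim: m => [|m IH]; first by rewrite mulr1.
    rewrite mulrS -[LHS]/(y * (val (u *+ m.+1)).1 * d 0 (val (u *+ m.+1)).2,
      0 + (val (u *+ m.+1)).2) IH /= addr0; congr pair.
    by rewrite [y ^+ m.+2]exprS [d 0 0 ^+ m.+1]exprSr !mulrA.
  apply: val_inj; rewrite un yx divfK ?expf_neq0 //.
  by rewrite [RHS]surjective_pairing -[(val x).2]/(deg x) x0.
have /choice[f hf] : forall a, exists x : E, x \in C /\ deg x = a.
  move=> a; have [x Cx] := CE (exist _ (1, a) (oner_neq0 k) : E).
  by rewrite inE degB subr_eq0 => /eqP ax; exists x.
exists (fun a => (val (f a)).1) => [a|a b]; first exact: (valP (f a)).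
have [[[Ca fa] [Cb fb]] [Cab fab]] := (hf a, hf b, hf (a + b)).
have : f (a + b) - (f a + f b) = 0.
  apply: CDI; last by rewrite inE degB degD fab fa fb subrr.
  by rewrite opprD addrA; apply: (CB) => //; apply: (CB).
move/subr0_eq => ->.
by rewrite -[LHS]/(_ * _ * d (deg (f a)) (deg (f b))) fa fb.
Qed.

Section CommutatorPairing.
Variables (k : fieldType) (G : zmodType) (c : G -> G -> k).
Hypothesis hc : two_cocycle c.

(** Three instances of the cocycle identity, for the triples (a, b, x),
(x, a, b) and (a, x, b). *)
Lemma commutator_pairingD a b x :
  c (a + b) x / c x (a + b) = (c a x / c x a) * (c b x / c x b).
Proof.
have [n0 cA] := hc.
have e1 := cA a b x; have e2 := cA x a b; have e3 := cA a x b.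
apply: (mulIf (n0 x (a + b))); rewrite divfK //.
apply: (mulIf (mulf_neq0 (n0 x a) (n0 x b))).
rewrite mulf_div mulrAC divfK ?mulf_neq0 //.
apply: (mulfI (mulf_neq0 (n0 a b) (n0 (x + a) b))).
rewrite !mulrA [LHS](ACl ((1*3)*2*4*5)) /= e1.
rewrite [RHS](ACl ((1*5)*2*3*4)) /= -e2.
rewrite [LHS](ACl ((5*2)*1*3*4)) /= [b + x]addrC -e3 [a + x]addrC.
by rewrite [LHS](ACl (5*2*4*1*3)).
Qed.

End CommutatorPairing.

(** The commutator pairing of c is an alternating bicharacter p with values in a
group C where square roots exist and are unique, so b = sqrt p is again one.
The cocycles b and c have the same commutator pairing, so their quotient is
symmetric, hence a coboundary, which m rescales away. *)
Lemma normalized_cocycle (k : closedFieldType) (G : zmodType) (c : G -> G -> k) :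
  two_cocycle c ->
  ~ in_generated_subgroup [set x | exists a b, x = c a b] (-1)
    \/ 2%N \in [pchar k] ->
  exists (b : G -> G -> k) (m : G -> k),
  [/\ forall x y z, b (x + y) z = b x z * b y z,
      forall x y, b x y * b y x = 1,
      forall x y, b x y ^+ 2 = 1 -> b x y = 1,
      forall x, m x != 0 &
      forall x y, m x * m y * c x y = m (x + y) * b x y].
Proof.
move=> hc hN; have [n0 cA] := hc.
have [C hC Cc] : exists2 C, square_root_group C & forall x y, c x y \in C.
  case: hN => [hN|k2]; last first.
    by exists ([pred x : k | x != 0] : pred k) => [|x y]; [exact: square_root_group_char2|exact: n0].
  have [H [HV H0 Hc HN]] : exists H : {pred k}, [/\ divr_closed H, 0 \notin H,
      forall x y, c x y \in H & -1 \notin H].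
    apply: contrapT => no; apply: hN => H HV H0 Hc; apply: contrapT => /negP HN.
    by apply: no; exists H; split=> // x y; apply: Hc; exists x, y.
  have [C hC HC] := square_root_group_above HV H0 HN.
  by exists C => // x y; apply/HC/Hc.
have [f [fC f2 fM]] := square_root_hom hC.
have [[C1 CV] C0 _ Cuniq] := hC.
pose p x y := c x y / c y x.
have pC x y : p x y \in C by apply: CV.
have f1 : f 1 = 1.
  by apply: Cuniq; rewrite ?fC // f2.
pose b x y := f (p x y).
have bD x y z : b (x + y) z = b x z * b y z.
  by rewrite /b -fM // /p commutator_pairingD.
have bV x y : b x y * b y x = 1.
  by rewrite /b -fM // /p mulf_div [c y x * _]mulrC divff ?mulf_neq0.
have b2 x y : b x y ^+ 2 = p x y by rewrite f2.
have bn0 x y : b x y != 0.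
  by apply: contraTneq (oner_neq0 k) => b0; rewrite -(bV x y) b0 mul0r eqxx.
have bDr x y z : b x (y + z) = b x y * b x z.
  apply: (mulIf (bn0 (y + z) x)); rewrite bV bD.
  by rewrite mulrACA !bV mulr1.
pose d x y := c x y / b x y.
have hd : symmetric_cocycle d.
  split; first split=> [x y|x y z].
  - by rewrite mulf_neq0 ?invr_neq0.
  - by rewrite /d !mulf_div cA bD bDr [b y z * _]mulrC mulrA.
  - move=> x y; rewrite /d; apply/eqP.
    rewrite eqr_div //; apply/eqP/(mulfI (bn0 x y)).
    rewrite mulrCA bV mulr1 mulrCA -expr2 b2 /p mulrC divfK //.
have [m m0 mD] := symmetric_cocycle_coboundary hd.
exists b, m; split=> // [x y|x y].
  by apply: Cuniq; apply: fC.
by rewrite mD /d -[RHS]mulrA divfK.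
Qed.

(** * Endomorphisms of simple modules are scalars *)

(** Induction on the number j of coordinates that are compared.  With F settling
the first j and N the largest next coordinate in F, an exponent whose next
coordinate is at least N is above a member of F, and each of the values below N
is settled by induction. *)
Lemma Dickson n (E : 'X_{1..n} -> Prop) : exists F : seq 'X_{1..n},
  (forall m, m \in F -> E m) /\ forall m, E m -> exists2 b, b \in F & lem b m.
Proof.
suff H : forall j (E' : 'X_{1..n} -> Prop), exists F : seq 'X_{1..n},
    (forall m, m \in F -> E' m) /\ forall m, E' m ->
    exists2 b, b \in F & forall i : 'I_n, (i < j)%N -> (b i <= m i)%N.
  have [F [FE EF]] := H n E.
  exists F; split=> // m /EF[b bF le_bm]; exists b => //.
  by apply/mnm_lepP => i; apply: le_bm.
elim=> [|j IH] {}E.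
  have [[m Em]|no] := pselect (exists m, E m); last first.
    by exists [::]; split=> // m Em; case: no; exists m.
  exists [:: m]; split=> [b|b Eb]; first by rewrite inE => /eqP ->.
  by exists m; rewrite ?inE.
have [lt_jn|le_nj] := ltnP j n; last first.
  have [F [FE EF]] := IH E; exists F; split=> // m /EF[b bF le_bm].
  exists b => // i _; apply: le_bm; exact: leq_trans (ltn_ord i) le_nj.
pose o := Ordinal lt_jn.
have [F [FE EF]] := IH E.
pose N := \max_(b <- F) (b o).
have /choice[Fs hFs] : forall d : nat, exists F' : seq 'X_{1..n},
    (forall m, m \in F' -> E m /\ m o = d) /\ forall m, E m /\ m o = d ->
    exists2 b, b \in F' & forall i : 'I_n, (i < j)%N -> (b i <= m i)%N.
  by move=> d; apply: IH (fun m => E m /\ m o = d).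
exists (F ++ flatten [seq Fs d | d <- iota 0 N]); split=> [m|m Em].
  rewrite mem_cat => /orP[/FE//|/flatten_mapP[d _]].
  by case: (hFs d) => h _ /h[].
have [lt_mN|le_Nm] := ltnP (m o) N.
  have [_ /(_ m (conj Em erefl))[b bF le_bm]] := hFs (m o).
  exists b; first by rewrite mem_cat; apply/orP; right; apply/flatten_mapP;
    exists (m o); rewrite ?mem_iota.
  move=> i; rewrite ltnS leq_eqVlt => /orP[/eqP ij|]; last exact: le_bm.
  have -> : i = o by apply: val_inj.
  by case: (hFs (m o)) => /(_ b bF)[_ ->].
have [b bF le_bm] := EF m Em; exists b; first by rewrite mem_cat bF.
move=> i; rewrite ltnS leq_eqVlt => /orP[/eqP ij|]; last exact: le_bm.
have -> : i = o by apply: val_inj.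
by apply: leq_trans le_Nm; apply: leq_bigmax_seq.
Qed.

(** An algebra spanned by monomials that multiply up to nonzero scalars, as in a
quantum affine space, and an endomorphism z of a simple module V.  If z is not
a scalar, the nonzero polynomials in z act bijectively by Schur's lemma, so V
is a vector space over k(z); the contradiction comes from generic freeness of V
over k[z], obtained from leading monomials. *)
Section SchurScalars.
Variables (k : closedFieldType) (A : algType k) (n : nat) (x : 'X_{1..n} -> A).
Hypothesis x0 : x 0%MM = 1.
Hypothesis xM : forall a b, exists2 u, u != 0 & x a * x b = u *: x (a + b)%MM.
Hypothesis xspan : forall S : {pred A}, submod_closed S -> (forall a, x a \in S) ->
  S =i predT.
Variables (V : lmodType A) (z : V -> V).
Hypothesis simV : simple_module V.
Hypotheses (zD : {morph z : u v / u + v}) (zA : forall a v, z (a *: v) = a *: z v).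
Implicit Types (p q : {poly k}) (v w : V) (a b : 'X_{1..n}).

Let z0 : z 0 = 0. Proof. by have := zA 0 0; rewrite !scale0r. Qed.
Lemma algA_comm (u : k) (d : A) v : d *: (u%:A *: v) = u%:A *: (d *: v).
Proof. by rewrite !scalerA mulr_algl mulr_algr. Qed.

Lemma algA_scale (u u' : k) v : u%:A *: (u'%:A *: v) = (u * u')%:A *: v :> V.
Proof. by rewrite scalerA mulr_algl scalerA. Qed.

(** The polynomial p evaluated at z, applied to v. *)
Definition act p v := \sum_(i < size p) (p`_i)%:A *: iter i z v.

Let iterA i d v : iter i z (d *: v) = d *: iter i z v.
Proof. by elim: i => //= i ->. Qed.
Let iterD i v w : iter i z (v + w) = iter i z v + iter i z w.
Proof. by elim: i => //= i ->. Qed.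

Let actE m p v : (size p <= m)%N -> act p v = \sum_(i < m) (p`_i)%:A *: iter i z v.
Proof.
move=> le_pm; rewrite /act (big_ord_widen _ (fun i => (p`_i)%:A *: iter i z v) le_pm).
rewrite big_mkcond; apply: eq_bigr => i _; case: ltnP => // le_pi.
by rewrite nth_default // !scale0r.
Qed.

Lemma actDr p v w : act p (v + w) = act p v + act p w.
Proof. by rewrite /act -big_split; apply: eq_bigr => i _; rewrite iterD scalerDr. Qed.

Lemma actA p (d : A) v : act p (d *: v) = d *: act p v.
Proof.
by rewrite /act scaler_sumr; apply: eq_bigr => i _; rewrite iterA algA_comm.
Qed.

Lemma act0r p : act p 0 = 0.
Proof. by have := actA p 0 0; rewrite !scale0r. Qed.

Lemma actDl p q v : act (p + q) v = act p v + act q v.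
Proof.
rewrite (actE v (size_polyD p q)) (actE v (leq_maxl (size p) (size q))).
rewrite (actE v (leq_maxr (size p) (size q))) -big_split.
by apply: eq_bigr => i _; rewrite coefD !scalerDl.
Qed.

Lemma act0 v : act 0 v = 0.
Proof. by rewrite /act size_poly0 big_ord0. Qed.

Lemma actC (u : k) v : act u%:P v = u%:A *: v.
Proof. by rewrite (actE v (size_polyC_leq1 u)) big_ord1 coefC. Qed.

Lemma actX p v : act (p * 'X) v = z (act p v).
Proof.
have -> : z (act p v) = \sum_(i < size p) (p`_i)%:A *: iter i.+1 z v.
  rewrite /act (big_morph z zD z0); apply: eq_bigr => i _; exact: zA.
rewrite (@actE (size p).+1); last first.
  by apply: leq_trans (size_polyMleq _ _) _; rewrite size_polyX addn2.
rewrite big_ord_recl coefMX eqxx !scale0r add0r.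
by apply: eq_bigr => i _; rewrite coefMX.
Qed.

Lemma actCM (u : k) q v : act (u%:P * q) v = u%:A *: act q v.
Proof.
rewrite (@actE (size q)) => [|//]; last by rewrite mul_polyC size_scale_leq.
rewrite scaler_sumr; apply: eq_bigr => i _.
by rewrite coefCM algA_scale.
Qed.

Lemma actM p q v : act (p * q) v = act p (act q v).
Proof.
elim/poly_ind: p v => [|p u IH] v; first by rewrite mul0r !act0.
rewrite mulrDl !actDl actX actCM actC; congr (_ + _).
by rewrite -mulrA ['X * q]mulrC mulrA actX IH.
Qed.

Hypothesis not_scalar : ~ exists u : k, forall v, z v = u%:A *: v.

Lemma act_XsubC (u : k) v : act ('X - u%:P) v = z v - u%:A *: v.
Proof.
rewrite -['X]mul1r -polyCN actDl actX !actC !scale1r.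
by rewrite !scaleNr.
Qed.

Lemma act_XsubC_inj (u : k) v : act ('X - u%:P) v = 0 -> v = 0.
Proof.
move=> hv; have [_ sim] := simV.
pose N : {pred V} := [pred w | act ('X - u%:P) w == 0].
have [|eN|eN] := sim N.
- split; first by rewrite inE act0r.
  move=> d w w' /eqP hw /eqP hw'; apply/eqP.
  by rewrite actDr actA hw hw' scaler0 addr0.
- have : v \in N by rewrite inE hv.
  by rewrite eN inE => /eqP.
case: not_scalar; exists u => w; apply/subr0_eq; rewrite -act_XsubC.
by have := eN w; rewrite !inE => /eqP.
Qed.

Lemma act_XsubC_surj (u : k) v : exists w, act ('X - u%:P) w = v.
Proof.
have [_ sim] := simV.
pose N : {pred V} := [pred v | `[< exists w, act ('X - u%:P) w = v >]].
have NP w : reflect (exists w', act ('X - u%:P) w' = w) (w \in N) by apply: asboolP.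
have [|eN|eN] := sim N; last by apply/NP; rewrite eN.
- split; first by apply/NP; exists 0; rewrite act0r.
  move=> d _ _ /NP[w <-] /NP[w' <-]; apply/NP; exists (d *: w + w').
  by rewrite actDr actA.
case: not_scalar; exists u => w; apply/subr0_eq; rewrite -act_XsubC.
by apply/eqP; rewrite -[_ == 0]eN; apply/NP; exists w.
Qed.

Lemma act_inj p v : p != 0 -> act p v = 0 -> v = 0.
Proof.
have [r ->] := closed_field_poly_normal p; set l := lead_coef p.
move=> /[dup] h; rewrite -mul_polyC => _; rewrite actCM => hv.
have l0 : l != 0 by apply: contraNneq h => ->; rewrite scale0r.
have {hv} : act (\prod_(u <- r) ('X - u%:P)) v = 0.
  have := congr1 (GRing.scale (l^-1)%:A) hv.
  by rewrite algA_scale mulVf // !scale1r scaler0.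
elim: r {h} => [|u r IH]; first by rewrite big_nil -polyC1 actC !scale1r.
by rewrite big_cons actM => /act_XsubC_inj/IH.
Qed.

Variable v0 : V.
Hypothesis v0_neq0 : v0 != 0.

Let gen (m : 'X_{1..n}) := x m *: v0.

(** The k[z]-span of the monomials in S applied to v0. *)
Definition spanned (S : 'X_{1..n} -> Prop) w :=
  exists l : seq ('X_{1..n} * {poly k}),
    (forall u, u \in l -> S u.1) /\ w = \sum_(u <- l) act u.2 (gen u.1).

Lemma spanned_ind (S : 'X_{1..n} -> Prop) (K : V -> Prop) : K 0 ->
  (forall v w, K v -> K w -> K (v + w)) -> (forall p m, S m -> K (act p (gen m))) ->
  forall w, spanned S w -> K w.
Proof.
move=> K0 KD Kg w [l [lS ->]]; rewrite big_seq.
by elim/big_ind: _ => // u /lS; apply: Kg.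
Qed.

Lemma spanned0 S : spanned S 0.
Proof. by exists [::]; rewrite big_nil. Qed.

Lemma spannedD S v w : spanned S v -> spanned S w -> spanned S (v + w).
Proof.
move=> [l [lS ->]] [l' [lS' ->]]; exists (l ++ l'); rewrite big_cat; split=> // u.
by rewrite mem_cat => /orP[/lS|/lS'].
Qed.

Lemma spanned_gen (S : 'X_{1..n} -> Prop) p m : S m -> spanned S (act p (gen m)).
Proof.
move=> Sm; exists [:: (m, p)]; rewrite big_seq1; split=> // u.
by rewrite inE => /eqP ->.
Qed.

Lemma spanned_act S p w : spanned S w -> spanned S (act p w).
Proof.
apply: (spanned_ind (K := fun w => spanned S (act p w))) => [|u v hu hv|q m Sm]; first by rewrite act0r; apply: spanned0.
  by rewrite actDr; apply: spannedD.
by rewrite -actM; apply: spanned_gen.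
Qed.

Lemma spannedZ S (u : k) w : u != 0 -> spanned S (u%:A *: w) -> spanned S w.
Proof.
move=> u0 /(spanned_act (u^-1)%:P); rewrite actC algA_scale mulVf //.
by rewrite !scale1r.
Qed.

Lemma genM a m : exists2 u : k, u != 0 & x a *: gen m = u%:A *: gen (a + m)%MM.
Proof.
have [u u0 e] := xM a m; exists u => //.
by rewrite /gen !scalerA e mulr_algl.
Qed.

(** Up to smaller monomials, p kills the monomial m: it is a leading coefficient
of a relation with leading monomial m. *)
Definition dependent m p :=
  p != 0 /\ spanned (fun a => (a < m)%O) (act p (gen m)).

(** Multiply the relation by the monomial a; the order on monomials is compatible
with addition of exponents. *)
Lemma dependent_add a m p : dependent m p -> dependent (a + m)%MM p.
Proof.
move=> [p0 hp]; split=> //; have [u u0 e] := genM a m.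
apply: (spannedZ u0); rewrite -actA -e actA.
move: hp; apply: (spanned_ind (K := fun w => spanned _ (x a *: w))) => [|v w|q b lt_bm]; first by rewrite scaler0; exact: spanned0.
  by rewrite scalerDr; apply: spannedD.
have [u' _ e'] := genM a b.
rewrite -actA e' actA -actC; apply/spanned_act/spanned_gen.
by rewrite ltmc_add2r.
Qed.

Lemma dependentM m p q : q != 0 -> dependent m p -> dependent m (q * p).
Proof.
by move=> q0 [p0 hp]; split; rewrite ?mulf_neq0 // actM; apply: spanned_act.
Qed.

(** By Dickson's lemma and [dependent_add], the product of finitely many leading
coefficients is one in every degree that has any. *)
Lemma common_denominator : exists2 f : {poly k}, f != 0 &
  forall m p, dependent m p -> dependent m f.
Proof.
have [F [FE EF]] := Dickson (fun m => exists p, dependent m p).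
have /choice[d hd] : forall m, exists p, p != 0 /\ (m \in F -> dependent m p).
  move=> m; have [/FE[p hp]|_] := boolP (m \in F); last by exists 1; rewrite oner_neq0.
  by exists p; split=> //; case: hp.
have d0 m : d m != 0 by case: (hd m).
exists (\prod_(m <- F) d m) => [|m p hp].
  by rewrite prodf_seq_neq0; apply/allP => m _; apply: d0.
have [|b bF /submK <-] := EF m; first by exists p.
apply: dependent_add; rewrite (big_rem b) //= mulrC; apply: dependentM.
  by rewrite prodf_seq_neq0; apply/allP => m' _; apply: d0.
by case: (hd b) => _; apply.
Qed.

Definition independent m := ~ exists p, dependent m p.

(** Well-founded induction on monomials: one factor f rewrites a dependent
monomial in terms of smaller ones. *)
Lemma eventually_spanned f : f != 0 -> (forall m p, dependent m p -> dependent m f) ->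
  forall w, exists d, spanned independent (act (f ^+ d) w).
Proof.
move=> f0 hf; pose good w := exists d, spanned independent (act (f ^+ d) w).
have goodD v w : good v -> good w -> good (v + w).
  move=> [d hd] [d' hd']; exists (d + d')%N; rewrite actDr; apply: spannedD.
    by rewrite addnC exprD actM; apply: spanned_act.
  by rewrite exprD actM; apply: spanned_act.
have good_act p w : good w -> good (act p w).
  by move=> [d hd]; exists d; rewrite -actM mulrC actM; apply: spanned_act.
have good0 : good 0 by exists 0%N; rewrite act0r; apply: spanned0.
have good_gen m : good (gen m).
  elim/(@ltmwf n): m => m IH; have [[p /hf[_ dep]]|ind] := pselect (exists p, dependent m p).
    have [d hd] : good (act f (gen m)).
      by apply: spanned_ind dep => // p' b lt_bm; apply/good_act/IH.
    by exists d.+1; rewrite exprSr actM.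
  by exists 0%N; apply: spanned_gen.
move=> w; have [_ sim] := simV.
have [d ->] : exists d : A, w = d *: v0.
  pose N : {pred V} := [pred w | `[< exists d : A, w = d *: v0 >]].
  have NP u : reflect (exists d : A, u = d *: v0) (u \in N) by apply: asboolP.
  have [|eN|eN] := sim N; last by apply/NP; rewrite eN.
    split; first by apply/NP; exists 0; rewrite scale0r.
    move=> e _ _ /NP[d ->] /NP[d' ->]; apply/NP; exists (e * d + d').
    by rewrite scalerDl scalerA.
  have : v0 \in N by apply/NP; exists 1; rewrite scale1r.
  by rewrite eN inE (negPf v0_neq0).
pose T : {pred A} := [pred d | `[< good (d *: v0) >]].
have TP e : reflect (good (e *: v0)) (e \in T) by apply: asboolP.
suff /TP : d \in T by [].
rewrite xspan // => [|a]; last by apply/TP; apply: good_gen.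
split; first by apply/TP; rewrite scale0r.
move=> u e e' /TP he /TP he'; apply/TP; rewrite scalerDl; apply: goodD => //.
by rewrite -mulr_algl -scalerA -actC; apply: good_act.
Qed.

Lemma exists_max (T : seq 'X_{1..n}) a : a \in T ->
  exists2 m, m \in T & forall b, b \in T -> (b <= m)%O.
Proof.
elim: T a => // m T IH a _; case: T IH => [|m' T] IH.
  by exists m => [|b]; rewrite inE // => /eqP ->.
have [b bT bmax] := IH m' (mem_head _ _).
have [le_mb|lt_bm] := leP m b.
  exists b => [|b']; rewrite inE ?bT ?orbT // => /orP[/eqP->//|]; exact: bmax.
exists m => [|b']; rewrite inE ?eqxx // => /orP[/eqP->//|/bmax le_b'].
exact: ltW (le_lt_trans le_b' lt_bm).
Qed.

(** Otherwise the largest exponent with a nonzero coefficient would be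
dependent. *)
Lemma independent_coef l : (forall u, u \in l -> independent u.1) ->
  \sum_(u <- l) act u.2 (gen u.1) = 0 ->
  forall m, \sum_(u <- l | u.1 == m) u.2 = 0.
Proof.
move=> lI l0; pose F m := \sum_(u <- l | u.1 == m) u.2.
pose T := undup [seq u.1 | u <- l].
have actF m : act (F m) (gen m) = \sum_(u <- l | u.1 == m) act u.2 (gen u.1).
  rewrite (big_morph (fun p => act p (gen m)) (fun p q => actDl p q (gen m)) (act0 (gen m))).
  by apply: eq_bigr => u /eqP ->.
have {}l0 : \sum_(m <- T) act (F m) (gen m) = 0.
  rewrite -[RHS]l0 (eq_bigr _ (fun m _ => actF m)) (exchange_big_dep xpredT) //=.
  apply: eq_big_seq => u ul; rewrite big_mkcond (bigD1_seq u.1) ?undup_uniq //=.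
    by rewrite eqxx big1 ?addr0 // => m; rewrite eq_sym => /negPf ->.
  by rewrite mem_undup map_f.
suff H m : m \in T -> F m = 0.
  move=> m; have [/H//|mT] := boolP (m \in T); rewrite big1_seq // => u /andP[/eqP um ul].
  by move: mT; rewrite mem_undup -um map_f.
move=> mT; apply/eqP/negPn/negP => Fm.
pose T' := [seq m <- T | F m != 0].
have [|b] := @exists_max T' m; first by rewrite mem_filter Fm.
rewrite mem_filter => /andP[Fb bT] bmax.
have : independent b.
  by move: bT; rewrite mem_undup => /mapP[u ul ->]; apply: lI.
apply; exists (F b); split=> //.
have -> : act (F b) (gen b) = - \sum_(a <- rem b T) act (F a) (gen a).
  by apply: (addIr (\sum_(a <- rem b T) act (F a) (gen a))); rewrite addNr -[RHS]l0 (big_rem b bT).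
have spannedN S w : spanned S w -> spanned S (- w).
  by move=> /(spanned_act (-1)%:P); rewrite actC !scaleN1r.
apply: spannedN; rewrite big_seq; elim/big_ind: _ => [|v w|a].
- exact: spanned0.
- exact: spannedD.
rewrite mem_rem_uniq ?undup_uniq // => /andP[/= ab aT].
have [->|Fa] := eqVneq (F a) 0; first by rewrite act0; apply: spanned0.
by apply: spanned_gen; rewrite lt_neqAle ab bmax // mem_filter Fa.
Qed.

(** Choose u with f.[u] != 0 and divide v0 by z - u.  Writing the quotient w, up
to a power of f, in independent monomials and comparing the coefficients of v0
shows that 'X - u divides a power of f. *)
Lemma scalar_contradiction : False.
Proof.
have [f f0 hf] := common_denominator.
have /closed_nonrootP[u fu] := f0.
have [w hw] := act_XsubC_surj u v0.
have [d [l [lI lw]]] := eventually_spanned f0 hf w.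
have ind0 : independent 0%MM.
  move=> [p [p0 [[|u' l'] [hl' e]]]]; last first.
    by have := hl' u' (mem_head _ _); rewrite ltNge le0m.
  by move: e; rewrite big_nil /gen x0 scale1r => /(act_inj p0)/eqP; apply/negP.
pose l' := (0%MM, - f ^+ d) :: [seq (t.1, ('X - u%:P) * t.2) | t <- l].
have : \sum_(t <- l' | t.1 == 0%MM) t.2 = 0.
  apply: independent_coef => [t|].
    by rewrite inE => /orP[/eqP->//|/mapP[t' /lI ht ->]]; exact: ht.
  rewrite big_cons big_map /= (eq_bigr (fun t => act ('X - u%:P) (act t.2 (gen t.1))));
    last by move=> t _; rewrite actM.
  rewrite -(big_morph _ (actDr ('X - u%:P)) (act0r _)) -lw -actM mulrC actM hw.
  by rewrite /gen x0 scale1r -actDl addNr act0.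
rewrite /l' big_cons /= eqxx big_map /= -mulr_sumr.
move=> /(congr1 (horner^~ u)); rewrite !hornerE subrr mul0r addr0 => /eqP.
by rewrite oppr_eq0 expf_eq0 => /andP[_]; apply/negP.
Qed.

End SchurScalars.

Lemma simple_endomorphism_scalar (k : closedFieldType) (A : algType k) (n : nat)
    (x : 'X_{1..n} -> A) (V : lmodType A) (z : V -> V) :
  x 0%MM = 1 ->
  (forall a b, exists2 u, u != 0 & x a * x b = u *: x (a + b)%MM) ->
  (forall S : {pred A}, submod_closed S -> (forall a, x a \in S) -> S =i predT) ->
  simple_module V ->
  {morph z : u v / u + v} -> (forall a v, z (a *: v) = a *: z v) ->
  exists u : k, forall v, z v = u%:A *: v.
Proof.
move=> x0 xM xspan simV zD zA; apply: contrapT => not_scalar.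
have [[v0 v0n0] _] := simV.
exact: (scalar_contradiction x0 xM xspan simV zD zA not_scalar v0n0).
Qed.

(** * Simple modules from maximal left ideals *)

Section QuotientModule.
Variables (A : nzRingType) (L : zmodClosed A).
Hypothesis LM : forall a x : A, x \in L -> a * x \in L.
Local Open Scope quotient_scope.

(** The additive quotient group, under a name that carries the stability of L by
left multiplication; the module structure depends on it. *)
Definition quotient_module of (forall a x : A, x \in L -> a * x \in L) :=
  Quotient.quot L.
Local Notation M := (quotient_module LM).

HB.instance Definition _ := GRing.Zmodule.on M.

Let pr (x : A) : M := \pi_(Quotient.quot L) x.

Let prE x y : pr x = pr y <-> x - y \in L.
Proof.
rewrite /pr; split=> [e|h]; first by rewrite Quotient.idealrBE; apply/eqP.
by apply/eqP; rewrite -Quotient.idealrBE.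
Qed.
Let prD x y : pr (x + y) = pr x + pr y.
Proof. exact: (Quotient.pi_add L x y). Qed.
Let prK (m : M) : pr (repr (m : Quotient.quot L)) = m.
Proof. exact: reprK. Qed.

Definition quotient_scale (a : A) (m : M) : M := pr (a * repr (m : Quotient.quot L)).

Let scaleE a x : quotient_scale a (pr x) = pr (a * x).
Proof. by apply/prE; rewrite -mulrBr; apply/LM/prE; rewrite prK. Qed.

Lemma quotient_scaleA a b m :
  quotient_scale a (quotient_scale b m) = quotient_scale (a * b) m.
Proof. by rewrite -[m]prK !scaleE mulrA. Qed.

Lemma quotient_scale1 : left_id 1 quotient_scale.
Proof. by move=> m; rewrite -[m]prK scaleE mul1r. Qed.

Lemma quotient_scaleDr : right_distributive quotient_scale +%R.
Proof.
move=> a m m'; rewrite -[m]prK -[m']prK -prD !scaleE -prD mulrDr //.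
Qed.

Lemma quotient_scaleDl m : {morph quotient_scale^~ m : a b / a + b}.
Proof. by move=> a b; rewrite -[m]prK !scaleE -prD mulrDl. Qed.

HB.instance Definition _ := GRing.Zmodule_isLmodule.Build A M
  quotient_scaleA quotient_scale1 quotient_scaleDr quotient_scaleDl.

Lemma quotient_module_cyclic : exists p : A -> M, [/\ forall m, exists x, p x = m,
  forall x, p x = 0 <-> x \in L & forall a b x, p (a * x + b) = a *: p x + p b].
Proof.
exists pr; split=> [m|x|a b x]; first by exists (repr (m : Quotient.quot L)).
  have p0 : pr 0 = 0 by apply: (addrI (pr 0)); rewrite -prD !addr0.
  by rewrite -p0; split=> [/prE|h]; rewrite ?subr0 //; apply/prE; rewrite subr0.
by rewrite prD -scaleE.
Qed.

End QuotientModule.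

Definition left_ideal (A : nzRingType) (L : {pred A}) := stable_subgroup *%R L.

Definition maximal_left_ideal (A : nzRingType) (L : {pred A}) :=
  [/\ left_ideal L, 1 \notin L & forall L', left_ideal L' -> {subset L <= L'} ->
      1 \notin L' -> {subset L' <= L}].

Lemma maximal_left_ideal_above (A : nzRingType) (L0 : {pred A}) :
  left_ideal L0 -> 1 \notin L0 ->
  exists2 L, maximal_left_ideal L & {subset L0 <= L}.
Proof.
move=> idL0 L01.
have [|L [idL L0L L1 Lmax]] := maximal_stable_subgroup (S := eq 1) idL0.
  by move=> _ <-.
exists L => //; split=> // [|L' idL' LL' L'1]; first exact: L1.
by apply: Lmax => // _ <-.
Qed.

Lemma simple_quotient (A : nzRingType) (L : {pred A}) : maximal_left_ideal L ->
  exists2 V : lmodType A, simple_module V &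
    forall a, (forall v : V, a *: v = 0) <-> forall b, a * b \in L.
Proof.
move=> [[[L0 LB] LM] L1 Lmax].
pose LZ := GRing.isZmodClosed.Build A L (conj L0 LB).
pose LC : zmodClosed A := HB.pack L LZ.
have LMC : forall a x : A, x \in LC -> a * x \in LC by exact: LM.
have [p [psurj p0 pD]] := quotient_module_cyclic LMC.
pose V : lmodType A := quotient_module LMC.
have p00 : p 0 = 0 by apply/p0.
have pM a x : p (a * x) = a *: p x by rewrite -[a * x]addr0 pD p00 addr0.
exists V; last first.
  move=> a; split=> [h b|h v].
    by suff : a * b \in LC by []; apply/p0; rewrite pM h.
  by have [x <-] := psurj v; rewrite -pM; apply/p0/h.
split.
  exists (p 1); apply/eqP => /p0 h; by rewrite [_ \in _]h in L1.
move=> N [N0 Nlin]; pose L' : {pred A} := [pred x | p x \in N].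
have idL' : left_ideal L'.
  split; first split; rewrite ?inE ?p00 //.
    move=> x y Nx Ny; rewrite inE (_ : x - y = -1 * y + x) ?pD; first exact: Nlin.
    by rewrite mulN1r addrC.
  move=> a x Nx; rewrite inE pM -[_ *: _]addr0; exact: Nlin.
have LL' : {subset L <= L'}.
  by move=> x Lx; rewrite inE (_ : p x = 0) //; apply/p0.
have [L'1|L'1] := boolP (1 \in L').
  right=> v; have [x <-] := psurj v.
  by case: idL' => _ /(_ x 1 L'1); rewrite mulr1.
left=> v; have [x <-] := psurj v; rewrite [RHS]inE.
apply/idP/eqP => [Nx|->//]; apply/p0; exact: (Lmax L').
Qed.

(** * Ideals and closed sets of the spectrum *)

Lemma idealZ (k : fieldType) (A : algType k) (I : {pred A}) (a : k) x :
  two_sided_ideal I -> x \in I -> a *: x \in I.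
Proof. by move=> [_ IM] Ix; rewrite -mulr_algl; case: (IM a%:A x Ix). Qed.

Lemma idealMl (A : pzRingType) (I : {pred A}) a x :
  two_sided_ideal I -> x \in I -> a * x \in I.
Proof. by move=> [_ IM] Ix; case: (IM a x Ix). Qed.

Lemma idealMr (A : pzRingType) (I : {pred A}) a x :
  two_sided_ideal I -> x \in I -> x * a \in I.
Proof. by move=> [_ IM] Ix; case: (IM a x Ix). Qed.

Lemma idealB (A : pzRingType) (I : {pred A}) x y :
  two_sided_ideal I -> x \in I -> y \in I -> x - y \in I.
Proof. by move=> [[_ IB] _]; apply: IB. Qed.

Lemma idealZ_eq (k : fieldType) (A : algType k) (I : {pred A}) (a : k) x :
  two_sided_ideal I -> a != 0 -> (a *: x \in I) = (x \in I).
Proof.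
move=> idI a0; apply/idP/idP => [/(idealZ a^-1 idI)|/(idealZ a idI)//].
by rewrite scalerA mulVf // scale1r.
Qed.

Section ClosedSets.
Variable A : pzRingType.

Lemma spec_eq (P Q : spec A) : (P : {pred A}) =i (Q : {pred A}) -> P = Q.
Proof.
case: P Q => [P prP] [Q prQ] /= PQ.
have ePQ : P = Q by apply: funext => x; apply: PQ.
by subst Q; congr Spec; apply: Prop_irrelevance.
Qed.

(** An arbitrary subset X may replace the ideal, because a prime contains X as
soon as it contains the ideal generated by X. *)
Lemma closed_spec (W : set (spec A)) :
  closed W <-> exists X : {pred A}, W = [set P | {subset X <= (P : {pred A})}].
Proof.
rewrite closed_specE; split=> [[I _ ->]|[X ->]]; first by exists I.
pose I : {pred A} := [pred a | `[< forall J : {pred A},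
  two_sided_ideal J -> {subset X <= J} -> a \in J >]].
have IP a : reflect (forall J : {pred A},
    two_sided_ideal J -> {subset X <= J} -> a \in J) (a \in I) by apply: asboolP.
exists I.
  split; first split.
  - by apply/IP => J hJ _; apply: ideal0.
  - move=> x y /IP hx /IP hy; apply/IP => J hJ XJ.
    by have [[_ JB] _] := hJ; apply: JB; [apply: hx|apply: hy].
  - by move=> a x /IP hx; split; apply/IP => J hJ XJ;
      have [_ /(_ a x (hx J hJ XJ))[]] := hJ.
apply/seteqP; split=> P hP x; last by move=> Xx; apply: hP; apply/IP => J _; apply.
by move=> /IP; apply=> //; case: (spec_prime P) => -[].
Qed.

Lemma closed_subspec (S : set (spec A)) (W : set S) : closed W <->
  exists X : {pred A}, W = [set P : S | {subset X <= (set_val P : {pred A})}].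
Proof.
split=> [|[X ->]].
  rewrite -openC => -[U oU UW].
  have /closed_spec[X XU] : closed (~` U) by exact: open_closedC.
  exists X; apply: funext => P; have := congr1 (@^~ (set_val P)) XU.
  rewrite /= => <-; have := congr1 (@^~ P) UW; rewrite /preimage /= => ->.
  by rewrite /setC /= notK.
have /closed_spec clX : exists X' : {pred A},
    [set P : spec A | {subset X <= (P : {pred A})}] =
    [set P : spec A | {subset X' <= (P : {pred A})}] by exists X.
rewrite -openC; exists (~` [set P : spec A | {subset X <= (P : {pred A})}]) => //.
exact: closed_openC.
Qed.

End ClosedSets.

(** * The coarser grading attached to a set of degrees *)

Section Twist.
Variables (k : closedFieldType) (G : zmodType) (R : comAlgType k) (RG : G -> {pred R}).
Variables (A : algType k) (phi : {linear R -> A}) (psi : A -> R) (c : G -> G -> k).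
Hypotheses (gr : grading RG) (phiK : cancel phi psi) (psiK : cancel psi phi).
Hypothesis cDl : forall x y z, c (x + y) z = c x z * c y z.
Hypothesis cV : forall x y, c x y * c y x = 1.
Hypothesis c2 : forall x y, c x y ^+ 2 = 1 -> c x y = 1.
Hypothesis phiM : forall a b, {in RG a & RG b, forall r s,
  phi r * phi s = c a b *: phi (r * s)}.

Implicit Types (q r s t : R) (g h : G) (D : G -> Prop) (P : {pred R}).
Local Notation wt := (wt RG).

Lemma c_neq0 x y : c x y != 0.
Proof. by apply: contraTneq (oner_neq0 k) => c0; rewrite -(cV x y) c0 mul0r eqxx. Qed.

Lemma c_inv x y : c y x = (c x y)^-1.
Proof. by apply: (mulfI (c_neq0 x y)); rewrite cV divff // c_neq0. Qed.

Lemma cDr x y z : c x (y + z) = c x y * c x z.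
Proof. by rewrite ![c x _]c_inv cDl invfM. Qed.

Lemma c0r x : c x 0 = 1.
Proof. by apply: (mulfI (c_neq0 x 0)); rewrite -cDr addr0 mulr1. Qed.

Lemma cxx x : c x x = 1.
Proof. by apply: c2; rewrite expr2 cV. Qed.

(** The commutation factors c h _ ^+ 2 in A separate the same degrees as c h _. *)
Lemma c_sqr_inj h g g' : c h g ^+ 2 = c h g' ^+ 2 -> c h g = c h g'.
Proof.
move=> e; rewrite -[g](subrK g') cDr c2 ?mul1r //.
apply: (mulIf (expf_neq0 2 (c_neq0 h g'))).
by rewrite mul1r -exprMn -cDr subrK.
Qed.

Lemma phi_homogeneousMl s h q : s \in RG h ->
  phi s * phi q = phi (s * wt (c h) q).
Proof.
move=> sG; elim/(homogeneous_ind gr): q => [|u v IHu IHv|g r rG].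
- by rewrite (wt0 gr) mulr0 linear0 mulr0.
- by rewrite (wtD gr) linearD mulrDr IHu IHv -linearD -mulrDr.
- by rewrite (phiM sG rG) (wt_homogeneous gr _ rG) -scalerAr linearZ.
Qed.

Lemma phi_homogeneousMr s h q : s \in RG h ->
  phi q * phi s = phi (s * wt (c ^~ h) q).
Proof.
move=> sG; elim/(homogeneous_ind gr): q => [|u v IHu IHv|g r rG].
- by rewrite (wt0 gr) mulr0 linear0 mul0r.
- by rewrite (wtD gr) linearD mulrDl IHu IHv -linearD -mulrDr.
- by rewrite (phiM rG sG) (wt_homogeneous gr _ rG) -scalerAr linearZ [r * s]mulrC.
Qed.

(** c 0 g = 1, so phi 1 is a left unit element of A. *)
Lemma phi1 : phi 1 = 1.
Proof.
have e q : phi 1 * phi q = phi q.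
  rewrite (phi_homogeneousMl q (homogeneous1 gr)) mul1r; congr (phi _).
  rewrite -[RHS]scale1r -(wt_const gr); apply: wt_ext => g.
  by rewrite c_inv c0r invr1.
by have := e (psi 1); rewrite psiK mulr1.
Qed.

Lemma psiB a b : psi (a - b) = psi a - psi b.
Proof. by apply: (can_inj phiK); rewrite linearB !psiK. Qed.

Lemma psiD a b : psi (a + b) = psi a + psi b.
Proof. by apply: (can_inj phiK); rewrite linearD !psiK. Qed.

Lemma phi_commute s h q : s \in RG h ->
  phi s * phi q = phi (wt (fun g => c h g ^+ 2) q) * phi s.
Proof.
move=> sG; rewrite (phi_homogeneousMl q sG) (phi_homogeneousMr _ sG) (wt_wt gr).
congr (phi (s * _)); apply: wt_ext => g.
by rewrite expr2 mulrA cV mul1r.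
Qed.

(** Equivalence of degrees, the indicator weight of the class of g0, and the
component of r in that class.  An element a has its degrees in the class of g0
when part D g0 a = a. *)
Definition sim D g g' := forall h, D h -> c h g = c h g'.
Definition cls D g0 g : k := (`[< sim D g0 g >])%:R.
Definition part D g0 r := wt (cls D g0) r.

Lemma sim_sym D g g' : sim D g g' -> sim D g' g.
Proof. by move=> e h /e. Qed.
Lemma sim_trans D g1 g2 g3 : sim D g1 g2 -> sim D g2 g3 -> sim D g1 g3.
Proof. by move=> e e' h Dh; rewrite (e h Dh) e'. Qed.

(** Classes are cosets of the subgroup of degrees on which all c h _, h in D, are
trivial. *)
Lemma sim_shift D a g g' : sim D (a + g) g' <-> sim D g (g' - a).
Proof.
split=> e h Dh; last by rewrite cDr e // -cDr addrC subrK.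
by apply: (mulfI (c_neq0 h a)); rewrite -!cDr e // addrC subrK.
Qed.

Lemma sim_cls D g0 g g' : sim D g g' -> cls D g0 g = cls D g0 g'.
Proof.
move=> e; congr (nat_of_bool _)%:R; apply: asbool_equiv_eq; split=> e'.
  exact: sim_trans e.
exact: sim_trans (sim_sym e).
Qed.

Lemma partD D g r s : part D g (r + s) = part D g r + part D g s.
Proof. exact: wtD. Qed.
Lemma partZ D g a r : part D g (a *: r) = a *: part D g r.
Proof. exact: wtZ. Qed.
Lemma part0 D g : part D g 0 = 0.
Proof. exact: wt0. Qed.

Lemma wt_part D w g0 r : (forall g, sim D g0 g -> w g = w g0) ->
  wt w (part D g0 r) = w g0 *: part D g0 r.
Proof.
move=> wE; rewrite (wt_wt gr) -wt_scale; apply: wt_ext => g; rewrite /cls.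
by case: asboolP => [/wE->|]; rewrite ?mulr1 ?mulr0.
Qed.

Lemma part_wt D w g0 r : (forall g, sim D g0 g -> w g = w g0) ->
  part D g0 (wt w r) = w g0 *: part D g0 r.
Proof.
move=> /wt_part <-; rewrite /part !(wt_wt gr); apply: wt_ext => g; exact: mulrC.
Qed.

Lemma part_part D g0 r : part D g0 (part D g0 r) = part D g0 r.
Proof.
rewrite {1}/part wt_part => [|g /sim_sym/sim_cls//].
by rewrite /cls asboolT ?scale1r.
Qed.

Lemma part_sim D g0 g1 r : sim D g0 g1 -> part D g0 r = part D g1 r.
Proof.
move=> e; apply: wt_ext => g; congr (nat_of_bool _)%:R.
apply: asbool_equiv_eq; split=> e'; last exact: sim_trans e'.
by apply: sim_trans e'; apply: sim_sym.
Qed.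

Lemma part_homogeneous D g r : r \in RG g -> part D g r = r.
Proof.
by move=> rG; rewrite /part (wt_homogeneous gr _ rG) /cls asboolT ?scale1r.
Qed.

Lemma part_homogeneousM D g0 h s r : s \in RG h ->
  part D g0 (s * r) = s * part D (g0 - h) r.
Proof.
move=> sG; rewrite /part (wt_homogeneousM gr _ _ sG); congr (_ * _).
apply: wt_ext => g; congr (nat_of_bool _)%:R; apply: asbool_equiv_eq.
split=> /sim_sym; first by move=> /sim_shift/sim_sym.
by move=> e; apply/sim_sym/sim_shift.
Qed.

Lemma part_classM D g0 h s r : s \in RG h -> part D g0 r = r ->
  part D (h + g0) (s * r) = s * r.
Proof. by move=> sG rE; rewrite (part_homogeneousM _ _ _ sG) addrC addKr rE. Qed.

Lemma wt_class D w g0 r : part D g0 r = r ->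
  (forall g, sim D g0 g -> w g = w g0) -> wt w r = w g0 *: r.
Proof. by move=> rE wE; rewrite -rE wt_part. Qed.

Lemma part_classMM D g0 g1 a b : part D g0 a = a -> part D g1 b = b ->
  part D (g0 + g1) (a * b) = a * b.
Proof.
move=> <- bE; elim/(homogeneous_ind gr): a => [|u v IHu IHv|h s sG].
- by rewrite part0 mul0r part0.
- by rewrite partD mulrDl partD IHu IHv.
have -> : part D g0 s = cls D g0 h *: s by rewrite /part (wt_homogeneous gr _ sG).
rewrite -scalerAl partZ.
rewrite /cls; case: asboolP => [e|_]; rewrite ?scale0r // !scale1r.
rewrite (part_homogeneousM _ _ _ sG); congr (_ * _).
rewrite (part_sim (g1 := g1)) // => x Dx.
by rewrite addrAC cDr (cDr x g0) (e x Dx) -(cDr x h) subrr c0r mul1r.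
Qed.

(** A property stable under the operators that commutation with homogeneous
elements induces passes from q to its parts.  If q has a degree g1 outside the
class of g0, some c h _ ^+ 2 - c h g1 ^+ 2 vanishes at g1 and is a nonzero
constant on the class of g0, so it removes g1 from the support of q and only
scales the part at g0. *)
Lemma part_ind D (X : R -> Prop) :
  (forall h m q, D h -> X q -> X (wt (fun g => c h g ^+ 2 - m) q)) ->
  (forall a q, a != 0 -> X (a *: q) -> X q) ->
  forall q g0, X q -> X (part D g0 q).
Proof.
move=> XT XZ q g0; have [l] := exists_support RG q.
have [n le_n] := ubnP (size l); elim: n l q le_n => // n IH l q le_n lq Xq.
have [all_l|] := pselect {in l, forall g, sim D g0 g}.
  suff -> : part D g0 q = q by [].
  rewrite -[RHS]scale1r -(wt_const gr); apply: lq => g gl.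
  by rewrite /cls asboolT //; apply: all_l.
move=> /existsNP[g1 /not_implyP[g1l /existsNP[h /not_implyP[Dh ne]]]].
pose w g := c h g ^+ 2 - c h g1 ^+ 2.
have : X (part D g0 (wt w q)).
  apply: (IH [seq g <- l | g != g1]); last exact: XT.
    rewrite -ltnS; apply: leq_trans le_n; rewrite ltnS size_filter.
    rewrite -(count_predC (pred1 g1)) -[X in (X < _)%N]add0n ltn_add2r.
    by rewrite -has_count has_pred1.
  by apply: (wt_supported_rem gr) => //; rewrite /w subrr.
rewrite part_wt; last by move=> g /(_ h Dh) e; rewrite /w e.
by apply: XZ; rewrite /w subr_eq0; apply/eqP => /c_sqr_inj.
Qed.

(** An element is the sum of its parts; the induction peels one class off the
support. *)
Lemma part_sum D (K : R -> Prop) q :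
  K 0 -> (forall r s, K r -> K s -> K (r + s)) ->
  (forall g0, K (part D g0 q)) -> K q.
Proof.
move=> K0 KD; have [l] := exists_support RG q.
have [n le_n] := ubnP (size l); elim: n l q le_n => // n IH [|g1 l] q le_n lq Kq.
  by rewrite (supported_nil gr lq).
pose w g := 1 - cls D g1 g.
have -> : q = part D g1 q + wt w q.
  rewrite -(wt_add RG) -[LHS]scale1r -(wt_const gr).
  by apply: wt_ext => g; rewrite /w addrC subrK.
apply: KD => //; apply: (IH [seq g <- g1 :: l | g != g1]).
- by rewrite /= eqxx /= -ltnS (leq_ltn_trans _ le_n) // ltnS size_filter count_size.
- by apply: (wt_supported_rem gr) => //; rewrite /w /cls asboolT ?subrr.
- move=> g0; rewrite part_wt => [|g e]; last by rewrite /w (sim_cls _ e).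
  by rewrite /w /cls; case: asboolP => _; rewrite ?subrr ?scale0r ?subr0 ?scale1r.
Qed.

(** * The core of a prime ideal *)

Definition degs P g := exists2 s, s \in RG g & s \notin P.
Definition preim_phi (Q : {pred A}) : {pred R} := [pred r | phi r \in Q].
Definition homogeneous_prime P := 1 \notin P /\
  forall g h r s, r \in RG g -> s \in RG h -> r * s \in P -> r \in P \/ s \in P.

Lemma degs0 P : homogeneous_prime P -> degs P 0.
Proof. by move=> [P1 _]; exists 1 => //; apply: homogeneous1. Qed.

Lemma degsD P g h : homogeneous_prime P -> degs P g -> degs P h -> degs P (g + h).
Proof.
move=> [_ PM] [s sG Ps] [t tG Pt]; exists (s * t); first exact: (homogeneousM gr).
by apply/negP => /(PM g h _ _ sG tG)[]; apply/negP.
Qed.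

(** Some homogeneous component of a is outside P, and it is nonzero, so its degree
is in the class of g0. *)
Lemma class_degs P a g0 : 0 \in P -> (forall r s, r \in P -> s \in P -> r + s \in P) ->
  part (degs P) g0 a = a -> a \notin P -> exists2 g, degs P g & sim (degs P) g0 g.
Proof.
move=> P0 PD aE Pa; have [l _ al] := sum_components gr a.
have [g Pg] : exists g, component RG g a \notin P.
  apply: contrapT => no; move/negP: Pa; apply; rewrite al.
  elim/big_ind: _ => // g _; apply/negPn/negP => Pg; apply: no; by exists g.
exists g; first by exists (component RG g a); rewrite ?component_homogeneous.
apply: contrapT => ne; move/negP: Pg; apply; rewrite -aE /component (wt_wt gr).
rewrite (wt_ext RG (w' := fun=> 0)) ?(wt_const gr) ?scale0r // => h.
by rewrite /cls; case: eqP => [->|_]; rewrite ?mul0r // asboolF ?mulr0.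
Qed.

(** Let X q say that phi q * A * phi s is inside I for some homogeneous s outside
P.  For t homogeneous of degree h outside P and y homogeneous, moving t to the
right in t q y s gives a nonzero multiple of q' y t s, where q' is q weighted by
c h _ ^+ 2.  So X q' holds with s replaced by the product of t and s, and X
passes to the parts of q by [part_ind]. *)
Lemma ideal_class_component P (I : {pred A}) q g0 : homogeneous_prime P ->
  two_sided_ideal I -> phi q \in I ->
  exists h s, [/\ s \in RG h, s \notin P &
    forall x, phi (part (degs P) g0 q) * x * phi s \in I].
Proof.
move=> hP idI Iq.
pose X q := exists h s, [/\ s \in RG h, s \notin P & forall x, phi q * x * phi s \in I].
apply: (part_ind (X := X)); last first.
- exists 0, 1; split=> [||x]; [exact: homogeneous1|by case: hP|].
  by rewrite phi1 mulr1; apply: idealMr.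
- move=> a r a0 [h [s [sG Ps Is]]]; exists h, s; split=> // x.
  by have := Is x; rewrite linearZ -!scalerAl (idealZ_eq _ idI).
move=> h m r [s sG Ps] [e [t [tG Pt It]]].
exists (h + e), (s * t); split; first exact: (homogeneousM gr).
  by case: hP => _ PM; apply/negP => /(PM h e _ _ sG tG)[]; apply/negP.
move=> x; rewrite -[x]psiK; elim/(homogeneous_ind gr): (psi x) => [|u v IHu IHv|d y yG].
- by rewrite linear0 mulr0 mul0r ideal0.
- by rewrite linearD mulrDr mulrDl idealD.
rewrite -(idealZ_eq _ idI (c_neq0 h e)) scalerAr -(phiM sG tG).
have -> : wt (fun g => c h g ^+ 2 - m) r = wt (fun g => c h g ^+ 2) r - m *: r.
  by rewrite -[m *: r](wt_const gr) -scaleN1r -wt_scale -wt_add; apply: wt_ext => g;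
    rewrite mulN1r.
rewrite linearB mulrBl mulrBl; apply: idealB => //; last first.
  by rewrite linearZ -!scalerAl idealZ // mulrA -[_ * _ * phi s]mulrA It.
have ys : phi y * phi s = c d h ^+ 2 *: (phi s * phi y).
  rewrite (phiM sG yG) (phiM yG sG) [s * y]mulrC scalerA; congr (_ *: _).
  by rewrite expr2 -mulrA cV mulr1.
rewrite mulrA -[_ * phi y * phi s]mulrA ys -scalerAr -scalerAl idealZ //.
by rewrite mulrA -(phi_commute r sG) -!mulrA; apply: idealMl => //; rewrite mulrA.
Qed.

(** The largest two-sided ideal contained in the additive group phi P. *)
Definition core P : {pred A} := [pred a | `[< forall x y, psi (x * a * y) \in P >]].

Lemma coreP P a : reflect (forall x y, psi (x * a * y) \in P) (a \in core P).
Proof. exact: asboolP. Qed.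

Lemma core_ideal P : zmod_closed P -> two_sided_ideal (core P).
Proof.
move=> [P0 PB]; split; first split.
- by apply/coreP => x y; rewrite mulr0 mul0r -(subrr 0) psiB subrr.
- move=> a b /coreP ha /coreP hb; apply/coreP => x y.
  by rewrite mulrBr mulrBl psiB PB.
- move=> b a /coreP ha; split; apply/coreP => x y; last by rewrite mulrA -mulrA ha.
  by rewrite mulrA ha.
Qed.

Lemma core_sub P r : phi r \in core P -> r \in P.
Proof. by move=> /coreP/(_ 1 1); rewrite mul1r mulr1 phiK. Qed.

Section CommutativeIdeal.
Variable P : {pred R}.
Hypothesis idP : two_sided_ideal P.
Local Notation D := (degs P).

(** Modulo P, multiplying by a with degrees in the class of g0 is the same in A
as in R up to the weight c g0 _ on b: components of b in P do not matter, and on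
a degree h of a component outside P the value c _ h is constant on the class of
g0. *)
Lemma class_product a b g0 : part D g0 a = a -> D g0 ->
  exists2 p, p \in P & phi a * phi b = phi (a * wt (c g0) b + p).
Proof.
move=> aE Dg0; elim/(homogeneous_ind gr): b => [|u v [p Pp IHu] [p' Pp' IHv]|h b bG].
- by exists 0; rewrite ?ideal0 // (wt0 gr) mulr0 addr0 linear0 mulr0.
- exists (p + p'); first exact: idealD.
  by rewrite (wtD gr) linearD !mulrDr IHu IHv -linearD addrACA.
rewrite (phi_homogeneousMr a bG).
have [Pb|Pb] := boolP (b \in P).
  exists (b * wt (c^~ h) a - a * wt (c g0) b); last by rewrite addrC subrK.
  rewrite (wt_homogeneous gr _ bG) -scalerAr; apply: idealB => //.
    exact: idealMr.
  by apply: idealZ => //; apply: idealMl.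
have Dh : D h by exists b.
exists 0; rewrite ?ideal0 // addr0 (wt_homogeneous gr _ bG).
rewrite (wt_class aE) -?scalerAr 1?[b * a]mulrC // => g e.
by rewrite c_inv -(e h Dh) -c_inv.
Qed.

Lemma class_productE a b g0 g1 : part D g0 a = a -> D g0 -> part D g1 b = b ->
  exists2 p, p \in P & phi a * phi b = phi (c g0 g1 *: (a * b) + p).
Proof.
move=> aE Dg0 bE; have [p Pp ->] := class_product b aE Dg0.
by exists p => //; rewrite (wt_class bE) -?scalerAr // => g /(_ g0 Dg0).
Qed.

Definition all_parts q := forall g0, part D g0 q \in P.

Lemma all_partsP q : all_parts q -> q \in P.
Proof.
by apply: (part_sum (K := fun q => q \in P)); [exact: ideal0|move=> ? ?; exact: idealD].
Qed.

(** The factor s either is in P or has its degree in D, and weights given by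
degrees in D are constant on classes. *)
Lemma all_parts_homogeneousM w s h q : s \in RG h ->
  (D h -> forall g0 g, sim D g0 g -> w g = w g0) ->
  all_parts q -> all_parts (s * wt w q).
Proof.
move=> sG wE Kq g0; rewrite (part_homogeneousM _ _ _ sG).
have [Ps|Ps] := boolP (s \in P); first exact: idealMr.
apply: idealMl => //; rewrite part_wt ?idealZ // => g; apply: wE.
by exists s.
Qed.

Lemma all_partsD q r : all_parts q -> all_parts r -> all_parts (q + r).
Proof. by move=> Kq Kr g0; rewrite partD idealD. Qed.

Lemma all_parts0 : all_parts 0.
Proof. by move=> g0; rewrite part0 ideal0. Qed.

Lemma all_partsMl x q : all_parts q -> all_parts (psi (x * phi q)).
Proof.
move=> Kq; rewrite -[x]psiK; elim/(homogeneous_ind gr): (psi x) => [|u v IHu IHv|h s sG].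
- by rewrite linear0 mul0r -(linear0 phi) phiK; apply: all_parts0.
- by rewrite linearD mulrDl psiD; apply: all_partsD.
rewrite (phi_homogeneousMl _ sG) phiK; apply: (all_parts_homogeneousM sG) => //.
by move=> Dh g0 g /(_ h Dh).
Qed.

Lemma all_partsMr x q : all_parts q -> all_parts (psi (phi q * x)).
Proof.
move=> Kq; rewrite -[x]psiK; elim/(homogeneous_ind gr): (psi x) => [|u v IHu IHv|h s sG].
- by rewrite linear0 mulr0 -(linear0 phi) phiK; apply: all_parts0.
- by rewrite linearD mulrDr psiD; apply: all_partsD.
rewrite (phi_homogeneousMr _ sG) phiK; apply: (all_parts_homogeneousM sG) => //.
by move=> Dh g0 g /(_ h Dh) e; rewrite c_inv -e -c_inv.
Qed.

Lemma all_parts_core q : all_parts q -> phi q \in core P.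
Proof.
move=> Kq; apply/coreP => x y; apply: all_partsP.
by rewrite -[x * phi q]psiK; apply/all_partsMr/all_partsMl.
Qed.

End CommutativeIdeal.

Lemma prime_homogeneous P : prime_two_sided_ideal P -> homogeneous_prime P.
Proof.
move=> prP; split; first by apply: proper1; case: prP.
by move=> g h r s _ _; apply: prime_comm.
Qed.

Lemma class_mulr D s h g0 q : s \in RG h -> D h ->
  phi (part D g0 q) * phi s = c g0 h *: phi (s * part D g0 q).
Proof.
move=> sG Dh; rewrite (phi_homogeneousMr _ sG) wt_part => [|g e].
  by rewrite -scalerAr linearZ.
by rewrite c_inv -(e h Dh) -c_inv.
Qed.

(** An ideal of A with an element outside core P contains one with a single part
outside P. *)
Lemma prime_ideal_class P (I : {pred A}) q g0 : prime_two_sided_ideal P ->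
  two_sided_ideal I -> phi q \in I -> part (degs P) g0 q \notin P ->
  exists g1 b, [/\ phi b \in I, part (degs P) g1 b = b, degs P g1 & b \notin P].
Proof.
move=> prP idI Iq Pq; have hP := prime_homogeneous prP.
have [[idP _] _] := prP.
have [h [s [sG Ps Is]]] := ideal_class_component g0 hP idI Iq.
have [g Dg eg] : exists2 g, degs P g & sim (degs P) g0 g.
  apply: (@class_degs P (part (degs P) g0 q)) => //; first exact: ideal0.
    by move=> ? ?; apply: idealD.
  exact: part_part.
have Dh : degs P h by exists s.
exists (h + g), (s * part (degs P) g0 q); split.
- by rewrite -(idealZ_eq _ idI (c_neq0 g0 h)) -class_mulr // -[phi (part _ _ _)]mulr1.
- by apply: part_classM => //; rewrite (part_sim _ eg) part_part.
- exact: degsD.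
- by apply/negP => /(prime_comm prP)[]; apply/negP.
Qed.

(** If phi q is in core P, so is phi (part q) * phi s for some homogeneous s
outside P, and then part q * s is in P.  Conversely the elements all of whose
parts are in P form a two-sided ideal of A. *)
Lemma core_parts P q : prime_two_sided_ideal P ->
  phi q \in core P <-> all_parts P q.
Proof.
move=> prP; have [[idP _] _] := prP; split; last exact: all_parts_core.
move=> Cq g0; apply/negPn/negP => Pq; have idC : two_sided_ideal (core P).
  by apply: core_ideal; case: idP.
have [g1 [b [Cb _ _ /negP]]] := prime_ideal_class prP idC Cq Pq.
by apply; apply: core_sub.
Qed.

(** Two ideals of A not inside core P contain elements u and v with a single part
outside P, and modulo P their product in A is a nonzero multiple of u * v. *)
Lemma core_prime P : prime_two_sided_ideal P -> prime_two_sided_ideal (core P).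
Proof.
move=> prP; have [[idP _] _] := prP.
have idC : two_sided_ideal (core P) by apply: core_ideal; case: idP.
apply: prime_intro => [|I J idI idJ a b Ia Ca Jb Cb].
  split=> //; exists 1; rewrite -phi1; apply/negP => /core_sub.
  by apply/negP; apply: proper1; case: prP.
have notparts x : x \notin core P -> exists g0, part (degs P) g0 (psi x) \notin P.
  rewrite -{1}[x]psiK => Cx; apply: contrapT => no; move/negP: Cx; apply.
  apply/core_parts => // g0; apply/negPn/negP => Px; by apply: no; exists g0.
have class x K : two_sided_ideal K -> x \in K -> x \notin core P ->
    exists g1 y, [/\ phi y \in K, part (degs P) g1 y = y, degs P g1 & y \notin P].
  move=> idK Kx /notparts[g0 Px]; apply: (prime_ideal_class prP idK _ Px).
  by rewrite psiK.
have [g1 [u [Iu uE Dg1 Pu]]] := class a I idI Ia Ca.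
have [g2 [v [Jv vE _ Pv]]] := class b J idJ Jb Cb.
exists (phi u * phi v); first exact: ideal_mulP.
have [p Pp ->] := class_productE idP uE Dg1 vE.
apply/negP => /core_sub Puv.
have : c g1 g2 *: (u * v) \in P by rewrite -[_ *: _](addrK p); apply: idealB.
by rewrite (idealZ_eq _ idP (c_neq0 _ _)) => /(prime_comm prP)[]; apply/negP.
Qed.

(** * Primes of R over a prime of the twist *)

Section PrimeOfTwist.
Variable Q : {pred A}.
Hypothesis prQ : prime_two_sided_ideal Q.
Let idQ : two_sided_ideal Q. Proof. by case: prQ => -[]. Qed.
Local Notation Qr := (preim_phi Q).
Local Notation D := (degs Qr).

Lemma preim_homogeneous_prime : homogeneous_prime Qr.
Proof.
split; first by rewrite inE phi1; apply: proper1; case: prQ.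
move=> g h r s rG sG; rewrite !inE => Qrs.
apply: (@prime_idealP A Q prQ (phi r) (phi s)) => x.
rewrite -[x]psiK (phi_commute _ rG) -mulrA (phiM rG sG).
by apply: idealMl => //; apply: idealZ.
Qed.

Lemma preim_zmod : zmod_closed Qr.
Proof.
split; first by rewrite inE linear0 ideal0.
by move=> u v; rewrite !inE linearB; apply: idealB.
Qed.

(** The separation of parts gives phi (part q) * A * phi s inside Q with phi s
outside Q. *)
Lemma preim_part q g0 : q \in Qr -> part D g0 q \in Qr.
Proof.
rewrite inE => Qq.
have [h [s [sG Qs Is]]] := ideal_class_component g0 preim_homogeneous_prime idQ Qq.
by have [//|Qs'] := prime_idealP prQ Is; rewrite inE Qs' in Qs.
Qed.

Lemma preim_parts q : (forall g0, part D g0 q \in Qr) -> q \in Qr.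
Proof.
apply: (part_sum (K := fun q => q \in Qr)) => [|u v]; rewrite !inE ?linear0 ?ideal0 //.
by rewrite linearD; apply: idealD.
Qed.

(** For s homogeneous outside Q, the products of s and of a part of q in R and
in A differ by a nonzero scalar. *)
Lemma preim_ideal : two_sided_ideal Qr.
Proof.
apply/ideal_comm; split; first exact: preim_zmod.
move=> a x Qx; elim/(homogeneous_ind gr): a => [|u v IHu IHv|h s sG].
- by rewrite mul0r inE linear0 ideal0.
- by move: IHu IHv; rewrite mulrDl !inE linearD; apply: idealD.
have [Qs|Qs] := boolP (s \in Qr).
  rewrite inE -[x]scale1r -(wt_const gr).
  have -> : wt (fun=> 1) x = wt (c h) (wt (fun g => (c h g)^-1) x).
    by rewrite (wt_wt gr); apply: wt_ext => g; rewrite divff ?c_neq0.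
  by rewrite -(phi_homogeneousMl _ sG); apply: idealMr.
have Dh : D h by exists s.
apply: preim_parts => g0; rewrite (part_homogeneousM _ _ _ sG).
rewrite inE -(idealZ_eq _ idQ (c_neq0 h (g0 - h))) -linearZ scalerAr.
rewrite -(wt_part (w := c h)) => [|g /(_ h Dh)//].
by rewrite -(phi_homogeneousMl _ sG); apply: idealMl => //; apply: preim_part.
Qed.

Lemma preim_class_degs a g0 : part D g0 a = a -> a \notin Qr ->
  exists2 g, D g & part D g a = a.
Proof.
move=> aE Qa; have [g Dg eg] := class_degs (ideal0 preim_ideal) (fun r s => @idealD _ _ r s preim_ideal) aE Qa.
by exists g => //; rewrite -(part_sim _ eg).
Qed.

(** With x homogeneous, phi a * phi x * phi b is modulo Q a multiple of
phi (x * a * b). *)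
Lemma preim_class_prime a b g0 g1 : part D g0 a = a -> part D g1 b = b ->
  a * b \in Qr -> a \in Qr \/ b \in Qr.
Proof.
move=> aE bE Qab; have [Qa|Qa] := boolP (a \in Qr); [by left|right].
have [g Dg {}aE] := preim_class_degs aE Qa.
suff : phi a \in Q \/ phi b \in Q by case=> // Qa'; rewrite inE Qa' in Qa.
apply: (@prime_idealP A Q prQ (phi a) (phi b)) => x; rewrite -[x]psiK.
elim/(homogeneous_ind gr): (psi x) => [|u v IHu IHv|h s sG].
- by rewrite linear0 mulr0 mul0r ideal0.
- by rewrite linearD mulrDr mulrDl idealD.
have [Qs|Qs] := boolP (s \in Qr).
  by apply: idealMr => //; apply: idealMl.
have Dh : D h by exists s.
have := class_mulr g a sG Dh; rewrite aE => ->; rewrite -scalerAl idealZ //.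
have sE := part_classM sG aE.
have Dhg := degsD preim_homogeneous_prime Dh Dg.
have [p Qp ->] := class_productE preim_ideal sE Dhg bE.
rewrite linearD idealD // linearZ idealZ // -mulrA.
by apply: (idealMl s preim_ideal Qab).
Qed.

Definition lies_over P := [/\ prime_two_sided_ideal P, {subset Qr <= P} &
  forall a g0, part D g0 a = a -> a \notin Qr -> a \notin P].

Lemma lies_over_core P : lies_over P -> core P =i Q.
Proof.
move=> [prP QP DP].
have eD : degs P = D.
  apply: funext => g; apply: propext; split=> -[s sG Ps]; exists s => //.
    by apply: contra Ps => /QP.
  by apply: (DP s g) => //; apply: part_homogeneous.
move=> a; rewrite -[a]psiK; apply/idP/idP.
  move=> /core_parts hP; suff : psi a \in Qr by [].
  apply: preim_parts => g0; apply/negPn/negP => Qa.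
  have := hP prP g0; rewrite eD; apply/negP; apply: DP Qa; exact: part_part.
move=> Qa; apply/core_parts => // g0; rewrite eD; apply: QP.
by apply: preim_part; rewrite inE.
Qed.

(** Suppose that q is in every prime over Q.  That property is stable under the
automorphisms of R given by the characters c h _ ^+ 2, which permute these
primes; so it passes to the parts of q.  One of them, say r, is outside Qr, and a
prime maximal above Qr without single-part elements outside Qr does not contain
r. *)
Lemma exists_lies_over q : q \notin Qr -> exists2 P, lies_over P & q \notin P.
Proof.
move=> Qq; apply: contrapT => no.
pose X r := forall P, lies_over P -> r \in P.
have Xq : X q by move=> P LP; apply/negPn/negP => Pq; apply: no; exists P.
have [g0 Qp] : exists g0, part D g0 q \notin Qr.
  apply: contrapT => nog; move/negP: Qq; apply; apply: preim_parts => g0.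
  by apply/negPn/negP => Qp; apply: nog; exists g0.
have Xp : X (part D g0 q).
  apply: (part_ind (X := X)) Xq => [h m r Dh Xr P [prP QP DP]|a r a0 Xr P LP]; last first.
    have [[[idP _] _] _ _] := LP.
    by have := Xr P LP; rewrite (idealZ_eq _ idP a0).
  have [[idP _] _] := prP; pose T := wt (fun g => c h g ^+ 2).
  have -> : wt (fun g => c h g ^+ 2 - m) r = T r - m *: r.
    by rewrite -[m *: r](wt_const gr) -scaleN1r -wt_scale -wt_add; apply: wt_ext => g;
      rewrite mulN1r.
  apply: idealB => //; last by apply: idealZ => //; apply: Xr.
  have T1 : T 1 = 1.
    by rewrite /T (wt_homogeneous gr _ (homogeneous1 gr)) c0r expr1n scale1r.
  have TM u v : T (u * v) = T u * T v.
    by apply: (wtM gr) => g g'; rewrite cDr exprMn.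
  apply: (Xr [pred r | T r \in P]); split.
  - apply: prime_comm_intro.
    + apply/ideal_comm; split; first split; rewrite ?inE /T ?(wt0 gr) ?ideal0 //.
        by move=> u v; rewrite !inE (wtB gr); apply: idealB.
      by move=> u v; rewrite !inE -!/(T _) TM; apply: idealMl.
    + by rewrite inE T1; apply: proper1; case: prP.
    + by move=> u v; rewrite !inE TM; apply: prime_comm.
  - move=> u Qu; rewrite inE; apply: QP; apply: preim_parts => g1.
    rewrite /T part_wt => [|g /(_ h Dh)->//].
    by rewrite (idealZ _ preim_ideal) ?preim_part.
  - move=> a g1 aE Qa; rewrite inE /T (wt_class aE) => [|g /(_ h Dh)->//].
    by rewrite (idealZ_eq _ idP) ?(DP a g1) // expf_neq0 ?c_neq0.
pose S a := exists2 g1, part D g1 a = a & a \notin Qr.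
have [|a b [g1 aE Qa] [g2 bE Qb]|a [g1 aE]//|P [prP QP SP]] :=
  @prime_avoiding R S Qr preim_ideal.
- exists 0; first by apply: part_homogeneous; apply: homogeneous1.
  by case: preim_homogeneous_prime.
- exists (g1 + g2); first exact: part_classMM.
  by apply/negP => /(preim_class_prime aE bE)[]; apply/negP.
have LP : lies_over P by split=> // a g1 aE Qa; apply: SP; exists g1.
have /negP[] : part D g0 q \notin P by apply: SP; exists g0 => //; apply: part_part.
exact: Xp.
Qed.

End PrimeOfTwist.

(** * Degrees and endomorphisms in the affine case *)

(** The homogeneous components of finitely many generators. *)
Lemma homogeneous_generators : affine R -> exists X : seq R,
  (forall x, x \in X -> exists g, x \in RG g) /\
  forall S : {pred R}, subalg_closed S -> {subset X <= S} -> S =i predT.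
Proof.
move=> [s gens].
have /choice[l hl] : forall r, exists l, r = \sum_(g <- l) component RG g r.
  by move=> r; have [l _ e] := sum_components gr r; exists l.
exists (flatten [seq [seq component RG g r | g <- l r] | r <- s]); split=> [x|S Salg XS].
  by move=> /flatten_mapP[r _ /mapP[g _ ->]]; exists g; apply: component_homogeneous.
apply: gens => // r rs; have [S1 Slin SM] := Salg; rewrite (hl r) big_seq.
have S0 : 0 \in S by rewrite -(subrr 1) addrC -scaleN1r Slin.
elim/big_ind: _ => // [u v Su Sv|g gl]; first by rewrite -[u]scale1r Slin.
by apply: XS; apply/flatten_mapP; exists r => //; apply: map_f.
Qed.

Lemma homogeneous_product (T : eqType) (s : seq T) (F : T -> R) :
  (forall x, x \in s -> exists g, F x \in RG g) ->
  exists g, \prod_(x <- s) F x \in RG g.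
Proof.
move=> h; rewrite big_seq; elim/big_ind: _ => //.
  by exists 0; apply: homogeneous1.
by move=> u v [g ug] [g' vg']; exists (g + g'); apply: (homogeneousM gr).
Qed.

Lemma homogeneousX n s g : s \in RG g -> s ^+ n \in RG (g *+ n).
Proof.
move=> sG; elim: n => [|n IH]; first by rewrite expr0 mulr0n; apply: homogeneous1.
by rewrite exprS mulrS; apply: (homogeneousM gr).
Qed.

(** The monomials in homogeneous generators of R span A and multiply there up to
the scalars c g h. *)
Lemma twist_simple_endomorphism (V : lmodType A) (z : V -> V) :
  affine R -> simple_module V ->
  {morph z : u v / u + v} -> (forall a v, z (a *: v) = a *: z v) ->
  exists u : k, forall v, z v = u%:A *: v.
Proof.
move=> affR simV zD zA; have [X [XG Xgen]] := homogeneous_generators affR.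
pose n := size X; pose mon (a : 'X_{1..n}) := \prod_(i < n) X`_i ^+ a i.
have mon0 : mon 0%MM = 1 by apply: big1 => i _; rewrite mnm0E expr0.
have monD a b : mon (a + b)%MM = mon a * mon b.
  by rewrite /mon -big_split; apply: eq_bigr => i _; rewrite mnmDE exprD.
have monG a : exists g, mon a \in RG g.
  apply: homogeneous_product => i _; have [g hg] := XG _ (mem_nth 0 (ltn_ord i)).
  by exists (g *+ a i); apply: homogeneousX.
apply: (simple_endomorphism_scalar (x := fun a => phi (mon a))) => //.
- by rewrite mon0 phi1.
- move=> a b; have [[g ag] [h bh]] := (monG a, monG b).
  by exists (c g h); rewrite ?c_neq0 // (phiM ag bh) monD.
move=> S [S0 Slin] Smon.
pose lin (T : {pred R}) := submod_closed T /\ forall a, mon a \in T.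
pose T : {pred R} := [pred r | `[< forall U, lin U -> r \in U >]].
have TP r : reflect (forall U, lin U -> r \in U) (r \in T) by apply: asboolP.
have linS : lin [pred r | phi r \in S].
  split=> //; split=> [|a u v Su Sv]; rewrite inE ?linear0 // linearP.
  exact: Slin.
have Tmon a : mon a \in T by apply/TP => U [_]; apply.
have Tlin : submod_closed T.
  split; first by apply/TP => U [[]].
  by move=> a u v /TP hu /TP hv; apply/TP => U hU; have [[_ Ul] _] := hU; apply: Ul; [apply: hu|apply: hv].
have Talg : subalg_closed T.
  split; [by rewrite -mon0; apply: Tmon|by case: Tlin|].
  move=> u v /TP hu /TP hv; apply/TP => U hU; have [[U0 Ul] Umon] := hU.
  apply: (hu [pred r | r * v \in U]); split=> [|a].
    split=> [|a r s Ur Us]; first by rewrite inE mul0r.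
    by rewrite inE mulrDl -scalerAl; apply: Ul.
  apply: (hv [pred r | mon a * r \in U]); split=> [|b].
    split=> [|d r s Ur Us]; first by rewrite inE mulr0.
    by rewrite inE mulrDr -scalerAr; apply: Ul.
  by rewrite inE -monD.
have TR : T =i predT.
  apply: Xgen => // x xX; pose i : 'I_n := Ordinal (etrans (index_mem x X) xX).
  suff <- : mon U_(i)%MM = x by apply: Tmon.
  rewrite /mon (bigD1 i) //= mnm1E eqxx expr1 nth_index // big1 ?mulr1 // => j ji.
  by rewrite mnm1E eq_sym (negPf ji) expr0.
by move=> a; have := TR (psi a); rewrite -[a in RHS]psiK => /TP/(_ _ linS); rewrite inE psiK.
Qed.

(** The degrees of the homogeneous elements outside P form a monoid, generated by the degrees
of the finitely many homogeneous generators outside P.  With w their sum, a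
multiple of w dominates any given element of the monoid. *)
Lemma degs_bound P : affine R -> two_sided_ideal P -> homogeneous_prime P ->
  exists2 w, degs P w & forall g, degs P g -> exists N, degs P (w *+ N - g).
Proof.
move=> affR idP hP; have [X [XG Xgen]] := homogeneous_generators affR.
have /choice[deg hdeg] : forall x, exists g, x \in X -> x \in RG g.
  move=> x; have [/XG[g xg]|] := boolP (x \in X); first by exists g.
  by exists 0.
pose l := [seq x <- X | x \notin P].
have Dl x : x \in l -> degs P (deg x).
  by rewrite mem_filter => /andP[Px xX]; exists x => //; apply: hdeg.
have Dsum (l' : seq R) : {subset l' <= l} -> degs P (\sum_(x <- l') deg x).
  move=> l'l; rewrite big_seq; elim/big_ind: _ => [||x /l'l/Dl//]; first exact: degs0.
  by move=> ? ?; apply: degsD.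
pose w := \sum_(x <- l) deg x; exists w; first exact: Dsum.
pose Y : {pred R} := [pred r | `[< forall g, component RG g r \notin P ->
   exists N, degs P (w *+ N - g) >]].
have YP r : reflect (forall g, component RG g r \notin P ->
   exists N, degs P (w *+ N - g)) (r \in Y) by apply: asboolP.
have comp_homog g h r : r \in RG h -> component RG g r \notin P -> g = h /\ r \notin P.
  move=> rh; rewrite /component (wt_homogeneous gr _ rh).
  by case: eqP => [->|_]; rewrite ?scale1r // scale0r ideal0.
move=> g [s sg Ps]; suff /YP/(_ g) : s \in Y.
  by apply; rewrite /component (wt_homogeneous gr _ sg) eqxx scale1r.
rewrite (Xgen Y) // => [|x xX].
  split.
  - apply/YP => h /(comp_homog _ _ _ (homogeneous1 gr))[-> _]; exists 0%N.
    by rewrite mulr0n subr0; apply: degs0.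
  - move=> a u v /YP hu /YP hv; apply/YP => h.
    rewrite (componentD gr) (componentZ gr) => Puv.
    have [Pu|/hu//] := boolP (component RG h u \in P).
    apply: hv; apply: contra Puv => Pv; apply: idealD => //; exact: idealZ.
  - move=> u v /YP hu /YP hv; apply/YP => h Puv.
    have [l' e] := componentM gr h u v.
    have [h' Pu Pv] : exists2 h', component RG h' u \notin P &
        component RG (h - h') v \notin P.
      apply: contrapT => no; move/negP: Puv; apply; rewrite e.
      apply: ideal_sum => // h' _.
      have [Pu|Pu] := boolP (component RG h' u \in P); first exact: idealMr.
      have [Pv|Pv] := boolP (component RG (h - h') v \in P); first exact: idealMl.
      by case: no; exists h'.
    have [[N1 D1] [N2 D2]] := (hu _ Pu, hv _ Pv); exists (N1 + N2)%N.
    have -> : w *+ (N1 + N2) - h = (w *+ N1 - h') + (w *+ N2 - (h - h')).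
      by rewrite mulrnDr opprB addrACA addKr.
    exact: degsD.
apply/YP => h /(comp_homog _ _ _ (hdeg x xX))[-> Px]; exists 1%N.
have xl : x \in l by rewrite mem_filter Px.
have -> : w *+ 1 - deg x = \sum_(y <- rem x l) deg y.
  by rewrite mulr1n /w (big_rem x xl) /= addrAC subrr add0r.
by apply: Dsum => y /mem_rem.
Qed.

Lemma sim_sub D g g' : sim D g g' <-> sim D 0 (g' - g).
Proof. by rewrite -{1}[g]addr0; split=> /sim_shift. Qed.

Lemma part_disjoint D g0 g1 r : ~ sim D g0 g1 -> part D g1 r = r -> part D g0 r = 0.
Proof.
move=> ne rE; rewrite {1}/part (wt_class rE) => [|g e].
  by rewrite /cls asboolF ?scale0r.
by rewrite -(sim_cls _ e).
Qed.

Lemma class_all_parts P g1 r : two_sided_ideal P -> part (degs P) g1 r = r ->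
  r \in P -> all_parts P r.
Proof.
move=> idP rE Pr g0; have [e|ne] := pselect (sim (degs P) g0 g1).
  by rewrite (part_sim _ e) rE.
by rewrite (part_disjoint ne rE) ideal0.
Qed.

(** Pigeonhole on a finite support of r. *)
Lemma finitely_many_parts D r (F : nat -> G) :
  (forall N, part D (F N) r != 0) -> exists i j, (i < j)%N /\ sim D (F i) (F j).
Proof.
have [l lr] := exists_support RG r => Fn0.
have /choice[f hf] : forall N, exists g, g \in l /\ sim D (F N) g.
  move=> N; apply: contrapT => no; move/eqP: (Fn0 N); apply.
  rewrite /part (lr _ (fun=> 0)) ?(wt_const gr) ?scale0r // => g gl.
  by rewrite /cls asboolF // => e; apply: no; exists g.
pose s := [seq f N | N <- iota 0 (size l).+1].
have : ~~ uniq s.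
  apply/negP => Us; have /(uniq_leq_size Us) : {subset s <= l}.
    by move=> _ /mapP[N _ ->]; case: (hf N).
  by rewrite size_map size_iota ltnn.
move=> /(uniqPn 0)[i [j [lt_ij]]]; rewrite size_map size_iota => lt_j.
rewrite !(nth_map 0%N) ?size_iota ?(ltn_trans lt_ij) // !nth_iota ?(ltn_trans lt_ij) //.
move=> e; exists i, j; split=> //; apply: sim_trans (hf i).2 _.
by rewrite -[i]add0n e; apply/sim_sym; case: (hf j).
Qed.

(** * The core of a maximal ideal is primitive *)

(** P is the kernel of a k-point e of R, and u is a homogeneous element outside P
whose degree w is interior to the monoid of degrees, in the sense of
[degs_bound]. *)
Section Kernel.
Variables (P : {pred R}) (e : {rmorphism R -> k}).
Hypotheses (eC : forall a, e a%:A = a) (Pe : forall x, (x \in P) = (e x == 0)).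

Let eZ a x : e (a *: x) = a * e x.
Proof. by rewrite -mulr_algl rmorphM /= eC. Qed.

Lemma kernel_maximal : maximal_two_sided_ideal P.
Proof.
have idealP : two_sided_ideal P.
  apply/ideal_comm; split; first split; rewrite ?Pe ?rmorph0 //.
    by move=> x y; rewrite !Pe rmorphB => /eqP-> /eqP->; rewrite subrr.
  by move=> a x; rewrite !Pe rmorphM => /eqP->; rewrite mulr0.
split; first by split=> //; exists 1; rewrite Pe rmorph1 oner_eq0.
move=> J idJ PJ; have [JP|] := pselect {subset J <= P}.
  by left=> x; apply/idP/idP => [/JP|/PJ].
move=> /existsNP[x /not_implyP[Jx]]; rewrite Pe => /negP ex; right=> y.
have J1 : 1 \in J.
  rewrite -(subrK ((e x)^-1 *: x) 1); apply: idealD => //; last exact: idealZ.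
  by apply: PJ; rewrite Pe rmorphB rmorph1 eZ mulVf // subrr.
by rewrite -[y]mulr1 inE; apply: idealMl.
Qed.

Let prP : prime_two_sided_ideal P. Proof. exact: maximal_prime kernel_maximal. Qed.
Let idP : two_sided_ideal P. Proof. by case: prP => -[]. Qed.
Local Notation D := (degs P).

Let idC : two_sided_ideal (core P).
Proof. by apply: core_ideal; case: idP. Qed.

Variables (w : G) (u : R).
Hypotheses (uw : u \in RG w) (Pu : u \notin P).
Hypothesis wD : forall g, D g -> exists N, D (w *+ N - g).

Let eu : e u != 0. Proof. by rewrite -Pe. Qed.
Let Dw : D w. Proof. by exists u. Qed.

Lemma phiX N : phi u ^+ N = phi (u ^+ N).
Proof.
elim: N => [|N IH]; first by rewrite !expr0 phi1.
rewrite exprS IH (phiM uw (homogeneousX N uw)) -exprS.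
suff -> : c w (w *+ N) = 1 by rewrite scale1r.
by elim: N {IH} => [|N IH]; rewrite ?mulr0n ?c0r // mulrS cDr cxx IH mulr1.
Qed.

(** The components of the coarser grading are lines modulo core P. *)
Lemma class_combination g1 a b : part D g1 a = a -> part D g1 b = b -> e b != 0 ->
  phi (a - (e a / e b) *: b) \in core P.
Proof.
move=> aE bE eb; apply: all_parts_core => //; apply: (@class_all_parts _ g1) => //.
  by rewrite partD -scaleN1r !partZ aE bE.
by rewrite Pe rmorphB eZ divfK // subrr.
Qed.

(** The ideal I contains phi b for some b with a single part outside P.  A multiple
t b has its degrees in the class of a multiple w *+ N, where u ^+ N also lies, so
u ^+ N is proportional to t b modulo core P. *)
Lemma ideal_above_core (I : {pred A}) a : two_sided_ideal I ->
  {subset core P <= I} -> a \in I -> a \notin core P -> exists N, phi u ^+ N \in I.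
Proof.
move=> idI CI Ia Ca.
have [g0 Pq] : exists g0, part D g0 (psi a) \notin P.
  apply: contrapT => no; move/negP: Ca; apply; rewrite -[a]psiK.
  apply/core_parts => // g0; apply/negPn/negP => Px; by apply: no; exists g0.
rewrite -[a]psiK in Ia.
have [g1 [b [Ib bE Dg1 Pb]]] := prime_ideal_class prP idI Ia Pq.
have [N [t tG Pt]] := wD Dg1; exists N; rewrite phiX.
have Dt : D (w *+ N - g1) by exists t.
have tbE : part D (w *+ N) (t * b) = t * b.
  by have := part_classM tG bE; rewrite subrK.
have etb : e (t * b) != 0 by rewrite rmorphM mulf_neq0 // -Pe.
have uE : part D (w *+ N) (u ^+ N) = u ^+ N.
  by apply: part_homogeneous; apply: homogeneousX.
rewrite -(subrK ((e (u ^+ N) / e (t * b)) *: (t * b)) (u ^+ N)) linearD.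
apply: idealD => //; first exact/CI/(class_combination uE tbE).
rewrite linearZ idealZ //= -(idealZ_eq _ idI (c_neq0 g1 (w *+ N - g1))).
by rewrite -{1}bE -class_mulr // bE; apply: idealMr.
Qed.

(** If phi u is left invertible modulo core P, no proper left ideal above core P
contains it.  Otherwise adjoin 1 - phi u; the result is proper.  Suppose indeed
that phi y * (1 - phi u) is 1 modulo core P.  The values E g of e on the parts
of y then satisfy E g = c' * E (g - w) with c' != 0, except that 1 is added when
g is in the class of 0.  So E is nonzero on all multiples w *+ N, or on the
opposites of all positive ones.  The degrees in play are finitely many, so a positive multiple of
w is in the class of 0; but then u ^+ N is a scalar modulo core P, and phi u is
left invertible. *)
Lemma left_ideal_avoiding : exists L0 : {pred A}, [/\ left_ideal L0, 1 \notin L0,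
  {subset core P <= L0} &
  forall L, left_ideal L -> {subset L0 <= L} -> phi u \in L -> 1 \in L].
Proof.
have C1 : 1 \notin core P by apply: proper1; case: (core_prime prP).
have [[v hv]|no] := pselect (exists v, 1 - v * phi u \in core P).
  exists (core P); split=> //; first by split; [case: idC|move=> *; apply: idealMl].
  move=> L [LZ LM] CL Lu; rewrite -(subrK (v * phi u) 1).
  by apply: zmod_closed_add => //; [exact: CL|exact: LM].
pose L0 : {pred A} := [pred a | `[< exists v, a - v * (1 - phi u) \in core P >]].
have L0P a : reflect (exists v, a - v * (1 - phi u) \in core P) (a \in L0).
  exact: asboolP.
have torsionfree_w N : (0 < N)%N -> ~ sim D 0 (w *+ N).
  case: N => // N _ sN; apply: no.
  have uN := homogeneousX N.+1 uw; have euN : e (u ^+ N.+1) != 0.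
    by rewrite rmorphXn /= expf_neq0.
  have hN : part D 0 (u ^+ N.+1) = u ^+ N.+1.
    by rewrite (part_sim _ sN) part_homogeneous.
  have := class_combination (part_homogeneous D (homogeneous1 gr)) hN euN.
  rewrite linearB phi1 linearZ /= -phiX [phi u ^+ _]exprSr scalerAl => h.
  by exists ((e 1 / e (u ^+ N.+1)) *: phi u ^+ N).
exists L0; split.
- split; first split.
  + by apply/L0P; exists 0; rewrite mul0r subr0 ideal0.
  + move=> a b /L0P[v hv] /L0P[v' hv']; apply/L0P; exists (v - v').
    have -> : a - b - (v - v') * (1 - phi u) =
        a - v * (1 - phi u) - (b - v' * (1 - phi u)).
      by rewrite mulrBl !opprB addrACA [- b + _]addrC addrACA.
    exact: idealB.
  + move=> a b /L0P[v hv]; apply/L0P; exists (a * v).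
    by rewrite -mulrA -mulrBr; apply: idealMl.
- apply/negP => /L0P[v]; rewrite -[v]psiK; set y := psi v.
  rewrite mulrBr mulr1 (phi_homogeneousMr _ uw) -phi1 -!linearB.
  move=> /(core_parts _ prP) hy.
  pose E g := e (part D g y).
  have rec g : E g = e (part D g 1) + e u * (c (g - w) w * E (g - w)).
    have := hy g; rewrite Pe => /eqP; rewrite opprB addrCA !partD.
    rewrite (part_homogeneousM _ _ _ uw) part_wt; last first.
      by move=> g' e'; rewrite c_inv -(e' w Dw) -c_inv.
    rewrite -scaleN1r partZ !rmorphD eZ rmorphM /= eZ mulN1r.
    by move=> /eqP; rewrite addrA subr_eq0 addrC => /eqP.
  have E0 g : E g != 0 -> part D g y != 0.
    by apply: contraNneq => h; rewrite /E h rmorph0.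
  have part1 g : ~ sim D g 0 -> part D g 1 = 0.
    by move=> ne; apply: part_disjoint ne _; apply: part_homogeneous; apply: homogeneous1.
  have [E00|E00] := eqVneq (E 0) 0.
    have En N : E (- (w *+ N.+1)) != 0.
      elim: N => [|N IH].
        have := rec 0; rewrite E00 (part_homogeneous _ (homogeneous1 gr)) rmorph1 sub0r.
        by apply: contra_eq_neq => ->; rewrite !mulr0 addr0 eq_sym oner_eq0.
      move: IH; rewrite rec part1 ?rmorph0 ?add0r.
        by rewrite !mulf_eq0 !negb_or => /and3P[_ _]; rewrite -opprD -mulrSr.
      move=> /sim_sub; rewrite sub0r opprK; exact: torsionfree_w.
    have [i [j [lt_ij /sim_sub]]] := finitely_many_parts (fun N => E0 _ (En N)).
    rewrite opprK => /sim_sym s.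
    apply: (@torsionfree_w (j - i)%N); first by rewrite subn_gt0.
    have -> : w *+ (j - i) = 0 - (- (w *+ j.+1) + w *+ i.+1).
      by rewrite sub0r opprD opprK -(mulrnBr w (leqW lt_ij)) subSS.
    by move/sim_sub: s.
  have En N : E (w *+ N) != 0.
    elim: N => [|N IH]; first by rewrite mulr0n.
    rewrite rec part1 ?rmorph0 ?add0r.
      by rewrite !mulf_eq0 !negb_or eu c_neq0 mulrSr addrK.
    by move=> /sim_sym; apply: torsionfree_w.
  have [i [j [lt_ij /sim_sub]]] := finitely_many_parts (fun N => E0 _ (En N)).
  by rewrite -(mulrnBr w (ltnW lt_ij)); apply: torsionfree_w; rewrite subn_gt0.
- by move=> a Ca; apply/L0P; exists 0; rewrite mul0r subr0.
- move=> L [LZ LM] LL Lu.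
  have h : 1 - phi u \in L.
    by apply: LL; apply/L0P; exists 1; rewrite mul1r subrr ideal0.
  by rewrite -(subrK (phi u) 1); apply: zmod_closed_add.
Qed.

(** The module V = A / L with L a maximal left ideal that avoids phi u.  Since
phi u is normal, phi u V is a submodule, nonzero because phi u is not in L, so
all powers of phi u act surjectively on V.  By [ideal_above_core] the
annihilator of V is then not larger than core P. *)
Lemma core_kernel_primitive : left_primitive (core P).
Proof.
have [L0 [idL0 L01 CL0 L0u]] := left_ideal_avoiding.
have [L maxL L0L] := maximal_left_ideal_above idL0 L01.
have [V simV annV] := simple_quotient maxL; exists V => // a.
have [[LZ LM] L1 Lmax] := maxL; have [LZ0 LB] := LZ.
have Lu : phi u \notin L.
  by apply: contra L1 => Lu; apply: (L0u L) => //; case: maxL.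
have div b : exists b', b - phi u * b' \in L.
  pose L' : {pred A} := [pred b | `[< exists b', b - phi u * b' \in L >]].
  have LP x : reflect (exists b', x - phi u * b' \in L) (x \in L') by apply: asboolP.
  have normal x : exists x', x * phi u = phi u * x'.
    pose x' := phi (wt (fun g => (c w g)^-1 * c g w) (psi x)); exists x'.
    rewrite -[x in LHS]psiK (phi_homogeneousMr _ uw) (phi_homogeneousMl _ uw) (wt_wt gr).
    by congr (phi (_ * _)); apply: wt_ext => g; rewrite mulVKf ?c_neq0.
  have idL' : left_ideal L'.
    split; first split.
    - by apply/LP; exists 0; rewrite mulr0 subr0.
    - move=> x y /LP[x' hx] /LP[y' hy]; apply/LP; exists (x' - y').
      have -> : x - y - phi u * (x' - y') = x - phi u * x' - (y - phi u * y').
        by rewrite mulrBr !opprB addrACA [- y + _]addrC addrACA.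
      exact: LB.
    - move=> x y /LP[y' hy]; have [x' hx] := normal x; apply/LP; exists (x' * y').
      by rewrite mulrA -hx -mulrA -mulrBr; apply: LM.
  have LL' : {subset L <= L'} by move=> x Lx; apply/LP; exists 0; rewrite mulr0 subr0.
  have L'1 : 1 \in L'.
    apply: contraT => /(Lmax L' idL' LL') L'L; case/negP: Lu; apply: L'L.
    by apply/LP; exists 1; rewrite mulr1 subrr.
  by apply/LP; rewrite -[b]mulr1; case: idL' => _; apply.
have divN N b : exists b', b - phi u ^+ N * b' \in L.
  elim: N b => [|N IH] b; first by exists b; rewrite expr0 mul1r subrr.
  have [b1 h1] := div b; have [b2 h2] := IH b1; exists b2.
  have -> : b - phi u ^+ N.+1 * b2 = b - phi u * b1 + phi u * (b1 - phi u ^+ N * b2).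
    by rewrite mulrBr addrA subrK mulrA -exprS.
  by apply: zmod_closed_add => //; apply: LM.
split=> [Ca|]; first by apply/annV => b; apply/L0L/CL0; apply: idealMr.
move=> /annV La; apply: contrapT => /negP Ca.
pose I : {pred A} := [pred x | `[< forall b, x * b \in L >]].
have IP x : reflect (forall b, x * b \in L) (x \in I) by apply: asboolP.
have idI : two_sided_ideal I.
  split; first split.
  - by apply/IP => b; rewrite mul0r.
  - by move=> x y /IP hx /IP hy; apply/IP => b; rewrite mulrBl LB.
  - move=> x y /IP hy; split; apply/IP => b; last by rewrite -mulrA.
    by rewrite -mulrA; apply: LM.
have CI : {subset core P <= I}.
  by move=> x Cx; apply/IP => b; apply/L0L/CL0; apply: idealMr.
have [N /IP IN] := ideal_above_core idI CI (introT (IP a) La) Ca.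
have [b hb] := divN N 1; move/negP: L1; apply.
by rewrite -(subrK (phi u ^+ N * b) 1); apply: zmod_closed_add.
Qed.

End Kernel.

(** * Maximal ideals of R over a primitive ideal of the twist *)

Lemma maximal_kernel P : affine R -> maximal_two_sided_ideal P ->
  exists e : {rmorphism R -> k}, (forall a, e a%:A = a) /\
    forall x, (x \in P) = (e x == 0).
Proof.
move=> affR maxP; have prP := maximal_prime maxP.
have P1 : 1 \notin P by apply: proper1; case: prP.
have [e [eC eP _]] := Nullstellensatz affR prP P1.
exists e; split=> // x.
pose J : {pred R} := [pred x | e x == 0].
have [maxJ _] := @kernel_maximal J e eC (fun=> erefl).
have PJ : {subset P <= J} by move=> y /eP; rewrite inE => /eqP.
case: maxP => _ /(_ J maxJ.1 PJ)[eJ|eJ]; first by rewrite -eJ.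
by have := eJ 1; rewrite !inE rmorph1 oner_eq0.
Qed.

Lemma core_maximal_primitive P : affine R -> maximal_two_sided_ideal P ->
  left_primitive (core P).
Proof.
move=> affR maxP; have prP := maximal_prime maxP.
have [e [eC Pe]] := maximal_kernel affR maxP.
have idP : two_sided_ideal P by case: prP => -[].
have [w [u uw Pu] wD] := degs_bound affR idP (prime_homogeneous prP).
exact: (core_kernel_primitive eC Pe uw Pu wD).
Qed.

Section PrimitiveOfTwist.
Variables (Q : {pred A}) (V : lmodType A).
Hypotheses (affR : affine R) (simV : simple_module V).
Hypothesis annV : forall a : A, a \in Q <-> forall v : V, a *: v = 0.
Let prQ : prime_two_sided_ideal Q.
Proof. by apply: left_primitive_prime; exists V. Qed.
Let idQ : two_sided_ideal Q. Proof. by case: prQ => -[]. Qed.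
Local Notation Qr := (preim_phi Q).
Local Notation D := (degs Qr).

(** Modulo Q, single-part elements are normal, with a commutation automorphism
that depends on the class only. *)
Lemma class_normal g0 b x : D g0 -> part D g0 b = b ->
  phi b * phi x - phi (wt (fun g => c g0 g ^+ 2) x) * phi b \in Q.
Proof.
move=> Dg0 bE; elim/(homogeneous_ind gr): x => [|r s hr hs|h x xG].
- by rewrite (wt0 gr) linear0 mulr0 mul0r subr0 ideal0.
- by rewrite (wtD gr) !linearD mulrDr mulrDl opprD addrACA idealD.
rewrite (wt_homogeneous gr _ xG) linearZ /= -scalerAl.
have [Qx|Qx] := boolP (x \in Qr).
  apply: idealB; [by []|exact: idealMl|apply: idealZ => //; exact: idealMr].
have Dh : D h by exists x.
have := class_mulr g0 b xG Dh; rewrite bE => ->.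
rewrite (phi_homogeneousMl _ xG) (wt_class bE) => [|g /(_ h Dh)//].
have -> : phi (x * (c h g0 *: b)) = c h g0 *: phi (x * b).
  by rewrite -scalerAr linearZ.
by rewrite scalerA expr2 -mulrA cV mulr1 subrr ideal0.
Qed.

(** By [class_normal] the kernel and the image of phi b are submodules of V, so
phi b acts bijectively, and the inverse of phi b composed with phi a commutes
with A.  Hence it is a scalar. *)
Lemma primitive_class_proportional g0 a b :
  part D g0 a = a -> part D g0 b = b -> b \notin Qr ->
  exists l : k, a - l *: b \in Qr.
Proof.
move=> aE bE Qb; have [g Dg e] : exists2 g, D g & sim D g0 g.
  have idQr := preim_ideal prQ.
  exact: class_degs (ideal0 idQr) (fun r s => @idealD _ _ r s idQr) bE Qb.
rewrite !(part_sim _ e) in aE bE.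
pose T := wt (fun g' => c g g' ^+ 2).
have TV d x v : part D g d = d -> phi d *: (phi x *: v) = phi (T x) *: (phi d *: v) :> V.
  move=> dE; have /annV/(_ v) := class_normal x Dg dE.
  by rewrite scalerBl -!scalerA => /subr0_eq.
have T_surj x : exists y, T y = x.
  exists (wt (fun g' => (c g g' ^+ 2)^-1) x); rewrite /T (wt_wt gr).
  rewrite -[RHS]scale1r -(wt_const gr); apply: wt_ext => g'.
  by rewrite divff // expf_neq0 ?c_neq0.
have [_ sim] := simV.
have inj (v : V) : phi b *: v = 0 -> v = 0.
  move=> bv; pose N : {pred V} := [pred v | phi b *: v == 0].
  have [|eN|eN] := sim N.
  - split=> [|d v1 v2]; rewrite !inE ?scaler0 // => /eqP h1 /eqP h2.
    by rewrite scalerDr h2 addr0 -[d]psiK TV // h1 scaler0.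
  - have : v \in N by rewrite inE bv.
    by rewrite eN inE => /eqP.
  case/negP: Qb; apply/annV => v1; apply/eqP.
  by have := eN v1; rewrite !inE.
have surj (v : V) : exists v', phi b *: v' = v.
  pose N : {pred V} := [pred v | `[< exists v', phi b *: v' = v >]].
  have NP v1 : reflect (exists v', phi b *: v' = v1) (v1 \in N) by apply: asboolP.
  have [|eN|eN] := sim N; last by apply/NP; rewrite eN.
    split; first by apply/NP; exists 0; rewrite scaler0.
    move=> d _ _ /NP[v1 <-] /NP[v2 <-]; apply/NP.
    have [y yd] := T_surj (psi d); exists (phi y *: v1 + v2).
    by rewrite scalerDr TV // yd psiK.
  case/negP: Qb; apply/annV => v1; apply/eqP.
  have : phi b *: v1 \in N by apply/NP; exists v1.
  by rewrite eN inE.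
have binj (v v' : V) : phi b *: v = phi b *: v' -> v = v'.
  by move=> h; apply/subr0_eq/inj; rewrite scalerBr h subrr.
have /choice[z hz] : forall v : V, exists v' : V, phi b *: v' = phi a *: v.
  by move=> v; apply: surj.
have [||l hl] := twist_simple_endomorphism (z := z) affR simV.
- by move=> v v'; apply: binj; rewrite scalerDr !hz scalerDr.
- by move=> d v; apply: binj; rewrite -[d]psiK hz (TV a) // (TV b) // hz.
exists l; rewrite inE linearB linearZ; apply/annV => v.
by rewrite scalerBl -hz hl scalerA mulr_algr subrr.
Qed.

(** A point e where u and q do not vanish on a prime over Q.  A single-part element
a outside Qr has a multiple t * a in the class of some u ^+ N, hence
proportional to u ^+ N modulo Qr, so e a != 0. *)
Lemma exists_maximal_lies_over q : q \notin Qr ->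
  exists P, [/\ maximal_two_sided_ideal P, lies_over Q P & q \notin P].
Proof.
move=> Qq; have hQ := preim_homogeneous_prime prQ; have idQr := preim_ideal prQ.
have [w [u uw Qu] wD] := degs_bound affR idQr hQ.
have [P0 [prP0 QP0 DP0] P0q] := exists_lies_over prQ Qq.
have P0u : u \notin P0 by apply: (DP0 u w) => //; apply: part_homogeneous.
have P0qu : q * u \notin P0.
  by apply/negP => /(prime_comm prP0)[]; apply/negP.
have [e [eC eP0 equ]] := Nullstellensatz affR prP0 P0qu.
pose P : {pred R} := [pred x | e x == 0].
have maxP : maximal_two_sided_ideal P := kernel_maximal eC (fun=> erefl).
have [eq eu] : e q != 0 /\ e u != 0.
  by move: equ; rewrite rmorphM mulf_eq0 negb_or => /andP.
have QP x : x \in Qr -> e x = 0 by move=> /QP0/eP0.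
exists P; split=> //; split; first exact: maximal_prime.
  by move=> x /QP ex; rewrite inE ex.
move=> a g0 aE Qa; rewrite inE.
have [g Dg {}aE] := preim_class_degs prQ aE Qa.
have [N [t tG Qt]] := wD g Dg.
have tE : part D (w *+ N - g) t = t by apply: part_homogeneous.
have taE : part D (w *+ N) (t * a) = t * a.
  by have := part_classM tG aE; rewrite subrK.
have Qta : t * a \notin Qr.
  by apply/negP => /(preim_class_prime prQ tE aE)[]; apply/negP.
have uE : part D (w *+ N) (u ^+ N) = u ^+ N.
  by apply: part_homogeneous; apply: homogeneousX.
have [l /QP] := primitive_class_proportional uE taE Qta.
rewrite rmorphB rmorphXn -mulr_algl !rmorphM /= eC => /subr0_eq h.
by apply: contraNneq (expf_neq0 N eu) => ea; rewrite h ea !mulr0.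
Qed.

End PrimitiveOfTwist.

(** * The quotient maps *)

(** The spectra and their subspaces of maximal and primitive ideals are treated
together: X and Y stand for either, embedded in the spectra by i and j. *)
Lemma core_quotient_map (X Y : topologicalType) (i : X -> spec R) (j : Y -> spec A)
    (f : X -> Y) :
  (forall W : set X, closed W <->
     exists I : {pred R}, W = [set x | {subset I <= (i x : {pred R})}]) ->
  (forall W : set Y, closed W <->
     exists I : {pred A}, W = [set y | {subset I <= (j y : {pred A})}]) ->
  injective j ->
  (forall x, j (f x) =i core (i x)) ->
  (forall y q, phi q \notin j y ->
     exists x, lies_over (j y) (i x) /\ q \notin i x) ->
  topological_quotient_map f.
Proof.
move=> clX clY injj fE fiber.
have lies_f x y : lies_over (j y) (i x) -> f x = y.
  move=> xy; apply/injj/spec_eq => a; rewrite fE.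
  exact: lies_over_core (spec_prime (j y)) _ xy a.
have surj y : exists2 x, f x = y & {subset preim_phi (j y) <= (i x : {pred R})}.
  have [|x [xy _]] := fiber y 1.
    by rewrite phi1; apply: proper1; case: (spec_prime (j y)).
  by exists x; [exact: lies_f|case: xy].
split; first by apply/seteqP; split=> // y _; have [x <- _] := surj y; exists x.
move=> W; split=> [/clY[I ->]|/clX[I fW]].
  pose I' : {pred R} := [pred r |
    `[< exists a b b', a \in I /\ r = psi (b * a * b') >]].
  apply/clX; exists I'.
  apply/seteqP; split=> x /= h.
    by move=> r /asboolP[a [b [b' [Ia ->]]]]; have := h a Ia; rewrite fE => /coreP.
  move=> a Ia; rewrite fE; apply/coreP => b b'; apply: h; apply/asboolP.
  by exists a, b, b'.
pose J : {pred A} := [pred a | `[< forall y, W y -> a \in j y >]].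
apply/clY; exists J.
apply/seteqP; split=> y /= hy; first by move=> a /asboolP; apply.
have [x fx sx] := surj y; rewrite -fx.
suff : (f @^-1` W) x by [].
rewrite fW => r Ir; apply: sx; rewrite inE; apply: hy; apply/asboolP => y' Wy'.
apply/negPn/negP => Qr; have [x' [x'y' /negP]] := fiber y' r Qr; apply.
suff : (f @^-1` W) x' by rewrite fW; apply.
by rewrite /= (lies_f _ _ x'y').
Qed.

Lemma twist_quotient_maps : affine R ->
  (exists f : spec R -> spec A, topological_quotient_map f) /\
  (exists g : maxspec R -> primspec A, topological_quotient_map g).
Proof.
move=> affR; split.
  exists (fun P : spec R => Spec (core_prime (spec_prime P))).
  apply: (core_quotient_map (i := id) (j := id)) => //; try exact: closed_spec.
  move=> Q q Qq; have [P LP Pq] := exists_lies_over (spec_prime Q) Qq.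
  by case: (LP) => prP _ _; exists (Spec prP).
have maxP (P : maxspec R) : maximal_two_sided_ideal (set_val P : spec R).
  by case: P => P mP; apply: (set_mem mP).
have prim (P : maxspec R) : Spec (core_prime (spec_prime (set_val P))) \in primspec A.
  by apply/mem_set; apply: core_maximal_primitive.
exists (fun P : maxspec R => (SigSub (prim P) : primspec A)).
apply: (core_quotient_map (i := set_val) (j := set_val)) => //; try exact: closed_subspec.
move=> Q q Qq; have [V simV annV] : left_primitive (set_val Q : spec A).
  by case: Q {q Qq} => Q mQ; apply: (set_mem mQ).
have [P [mP LP Pq]] := exists_maximal_lies_over affR simV annV Qq.
have mP' : (Spec (maximal_prime mP) : spec R) \in maxspec R by apply/mem_set.
by exists (SigSub mP').
Qed.

End Twist.

Theorem mainTheorem2 (k : closedFieldType) (G : zmodType) (R : comAlgType k)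
    (RG : G -> {pred R}) (c : G -> G -> k)
    (A : algType k) (AG : G -> {pred A}) (phi : {linear R -> A}) :
  torsionfree G ->
  affine R ->
  grading RG ->
  two_cocycle c ->
  is_twist c RG AG phi ->
  ~ in_generated_subgroup [set x | exists a b, x = c a b] (-1)
    \/ 2%N \in [pchar k] ->
  (exists f : spec R -> spec A, topological_quotient_map f) /\
  (exists g : maxspec R -> primspec A, topological_quotient_map g).
Proof.
move=> _ affR gr hc [_ [psi phiK psiK] _ phiM] hN.
have [b [m [bD bV b2 m0 bm]]] := normalized_cocycle hc hN.
(* Rescaling by m replaces the cocycle c by b. *)
pose phi' r := phi (wt RG m r).
have phi'_linear : linear phi'.
  by move=> a r s; rewrite /phi' wt_linear // linearP.
pose linM := GRing.isLinear.Build k R A *:%R phi' phi'_linear.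
pose Phi : {linear R -> A} := HB.pack phi' linM.
pose psi' a := wt RG (fun g => (m g)^-1) (psi a).
have wtV (w w' : G -> k) r : (forall g, w g * w' g = 1) -> wt RG w (wt RG w' r) = r.
  move=> ww'; rewrite (wt_wt gr) -[RHS]scale1r -(wt_const gr).
  by apply: wt_ext => g; apply: ww'.
have PhiK : cancel Phi psi'.
  by move=> r; rewrite /psi' /= /phi' phiK wtV // => g; rewrite mulVf.
have psi'K : cancel psi' Phi.
  by move=> a; rewrite /= /phi' /psi' wtV ?psiK // => g; rewrite divff.
have PhiM g h : {in RG g & RG h, forall r s, Phi r * Phi s = b g h *: Phi (r * s)}.
  move=> r s rG sG; rewrite /= /phi' !(wt_homogeneous gr _ rG, wt_homogeneous gr _ sG).
  rewrite (wt_homogeneous gr _ (homogeneousM gr rG sG)) !linearZ /=.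
  by rewrite -scalerAl -scalerAr (phiM g h) // !scalerA bm mulrC.
exact: (twist_quotient_maps gr PhiK psi'K bD bV b2 PhiM affR).
Qed.
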